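(* Let $m$ be a positive integer such that the class number $h_m$ of $\mathbb{Q}(\zeta_m)$ satisfies $h_m\ge 2$. Let $t\ge 1$ and $e\ge 0$ be rational integers and $q$ a rational prime with $q\nmid t$, $\gcd(q,m)=1$, $\mathrm{ord}_m(q)=\varphi(m)/2$, and $\gcd(2e+1-2k,h_m)=1$ for all integers $0\le k\le e-1$. Suppose that every prime ideal $\mathfrak t$ of $\mathbb{Z}[\zeta_m]$ dividing $(t)$ is principal and every prime ideal $\mathfrak q$ of $\mathbb{Z}[\zeta_m]$ dividing $(q)$ is non-principal. Then the equation $\alpha\overline{\alpha}=tq^{2e+1}$ has no solution $\alpha\in\mathbb{Z}[\zeta_m]$.
   Context: $\zeta_m$ is a primitive complex $m$-th root of unity, $\overline{\alpha}$ is complex conjugation, $\varphi$ is Euler's totient function, $\mathrm{ord}_m(q)$ is the multiplicative order of $q$ modulo $m$, and $h_m$ is the class number of the cyclotomic field $\mathbb{Q}(\zeta_m)$. *)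

(* Defs.v *)
From HB Require Import structures.
From mathcomp Require Import all_boot all_order all_algebra all_field.
From mathcomp Require Import finmap boolp classical_sets functions cardinality.

Set Implicit Arguments.
Unset Strict Implicit.
Unset Printing Implicit Defensive.

Import Order.TTheory GRing.Theory Num.Theory.

Local Open Scope classical_set_scope.
Local Open Scope ring_scope.

(* All rings, fields and ideals are subsets of algC, the field of algebraic
   complex numbers with complex conjugation z^*. *)

Definition int_adjoin (z : algC) : set algC :=
  [set x | exists p : {poly int}, x = (map_poly intr p).[z]].

Definition rat_adjoin (z : algC) : set algC :=
  [set x | exists p q : {poly rat},
     (map_poly ratr q).[z] != 0 /\
     x = (map_poly ratr p).[z] / (map_poly ratr q).[z]].

Definition ring_of_integers (K : set algC) : set algC :=
  [set x | K x /\ x \in Aint].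

(* The predicates below are meant for a subring R of algC; closure of an ideal
   under opposites then follows from -1 being in R. *)

Definition is_ideal (R I : set algC) : Prop :=
  [/\ I `<=` R,
      I 0,
      (forall x y, I x -> I y -> I (x + y))
    & (forall a x, R a -> I x -> I (a * x))].

Definition is_nonzero_ideal (R I : set algC) : Prop :=
  is_ideal R I /\ exists2 x, I x & x != 0.

Definition is_prime_ideal (R P : set algC) : Prop :=
  [/\ is_ideal R P,
      P <> R
    & (forall x y, R x -> R y -> P (x * y) -> P x \/ P y)].

Definition scale_set (a : algC) (I : set algC) : set algC :=
  [set a * x | x in I].

Definition principal_ideal (R : set algC) (a : algC) : set algC :=
  scale_set a R.

Definition is_principal (R I : set algC) : Prop :=
  exists2 a, R a & I = principal_ideal R a.

Definition ideal_mul (I J : set algC) : set algC :=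
  [set x | exists (n : nat) (a b : 'I_n -> algC),
     [/\ forall i, I (a i), forall i, J (b i) & x = \sum_(i < n) a i * b i]].

Definition ideal_divides (R I J : set algC) : Prop :=
  exists2 K, is_ideal R K & J = ideal_mul I K.

Definition ideal_equiv (R I J : set algC) : Prop :=
  exists a b, [/\ R a, R b, a != 0, b != 0 & scale_set a I = scale_set b J].

Definition ideal_class (R I : set algC) : set (set algC) :=
  [set J | is_nonzero_ideal R J /\ ideal_equiv R I J].

Definition ideal_classes (R : set algC) : set (set (set algC)) :=
  [set ideal_class R I | I in [set I | is_nonzero_ideal R I]].

(* fset_set A is empty when A is infinite; the set of ideal classes of a number
   field is finite, so this is the usual class number. *)
Definition class_number (K : set algC) : nat :=
  #|` fset_set (ideal_classes (ring_of_integers K))|%fset.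

Definition is_mult_order (m q d : nat) : Prop :=
  [/\ (0 < d)%N,
      q ^ d = 1 %[mod m]
    & (forall j : nat, (0 < j)%N -> q ^ j = 1 %[mod m] -> (d <= j)%N)].

(* Main.v *)
Require Import Defs.
From HB Require Import structures.
From mathcomp Require Import all_boot all_order all_algebra all_field.
From mathcomp Require Import all_fingroup all_solvable ring.
From mathcomp Require Import finmap boolp classical_sets functions cardinality.

(* Write A = Z[z]. Call a nonzero element a of A periodic if some power map
   y |-> y ^ N with N > 1 is the identity on A / a; then A / a is reduced. By the
   Frobenius, every rational prime is a product of periodic elements: itself if it
   is prime to m, and differences of p-power roots of unity if p divides m. If a is
   periodic and x / a is integral then x ^ d lies in (a), so x does: hence A is the
   full ring of integers. Idempotents of A / a show that prime ideals are
   invertible.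

   Since q has order phi(m) / 2, a prime Q above q has at most two Galois
   conjugates Q and R, and their intersection is (q); as no prime above q is
   principal, Q <> R and QR = (q). Dividing alpha by q while possible, we may assume
   that alpha is not in (q), with q-exponent n = 2 e' + 1, e' <= e. If complex
   conjugation fixed Q and R, alpha would lie in both. So it swaps them, and after
   removing the principal prime factors of t we get x w = q ^ n with x outside Q and
   w outside R, whence R ^ n = (x). Multiplication by R acts on the finite set of
   ideal classes; R ^ n acts trivially, and a power of R that fixes one class is
   principal, so all orbits have the same length, dividing both n and h. These
   being coprime, R is principal, a contradiction. *)

Set Implicit Arguments.
Unset Strict Implicit.
Unset Printing Implicit Defensive.

Import Order.TTheory GRing.Theory Num.Theory.

Local Open Scope classical_set_scope.
Local Open Scope ring_scope.

(** * The subring Z[z] of the algebraic numbers *)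

Definition int_adjoin_pred (z : algC) : {pred algC} :=
  fun x => `[< int_adjoin z x >].

Lemma int_adjoinP z x : reflect (int_adjoin z x) (x \in int_adjoin_pred z).
Proof. exact: asboolP. Qed.

Lemma int_adjoin_subring z : subring_closed (int_adjoin_pred z).
Proof.
split=> [|x y /int_adjoinP[p ->] /int_adjoinP[p' ->]
         |x y /int_adjoinP[p ->] /int_adjoinP[p' ->]]; apply/int_adjoinP.
- by exists 1; rewrite rmorph1 hornerC.
- by exists (p - p'); rewrite rmorphB hornerD hornerN.
- by exists (p * p'); rewrite rmorphM hornerM.
Qed.

HB.instance Definition _ z :=
  GRing.isSubringClosed.Build _ (int_adjoin_pred z) (int_adjoin_subring z).

Section IntAdjoin.

Variable z : algC.
Local Notation A := (int_adjoin z).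

Lemma adj0 : A 0. Proof. by apply/int_adjoinP; exact: rpred0. Qed.
Lemma adj1 : A 1. Proof. by apply/int_adjoinP; exact: rpred1. Qed.
Lemma adj_nat n : A n%:R. Proof. by apply/int_adjoinP; exact: rpred_nat. Qed.
Lemma adj_int n : A n%:~R. Proof. by apply/int_adjoinP; exact: rpred_int. Qed.

Lemma adj_gen : A z. Proof. by exists 'X; rewrite map_polyX hornerX. Qed.

Lemma adjD x y : A x -> A y -> A (x + y).
Proof. by move=> /int_adjoinP ? /int_adjoinP ?; apply/int_adjoinP; exact: rpredD. Qed.

Lemma adjN x : A x -> A (- x).
Proof. by move=> /int_adjoinP Ax; apply/int_adjoinP; rewrite rpredN. Qed.

Lemma adjB x y : A x -> A y -> A (x - y).
Proof. by move=> /int_adjoinP ? /int_adjoinP ?; apply/int_adjoinP; exact: rpredB. Qed.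

Lemma adjM x y : A x -> A y -> A (x * y).
Proof. by move=> /int_adjoinP ? /int_adjoinP ?; apply/int_adjoinP; exact: rpredM. Qed.

Lemma adjX x n : A x -> A (x ^+ n).
Proof. by move=> /int_adjoinP ?; apply/int_adjoinP; exact: rpredX. Qed.

Lemma adj_sum I (r : seq I) (P : pred I) F :
  (forall i, P i -> A (F i)) -> A (\sum_(i <- r | P i) F i).
Proof. by move=> AF; apply/int_adjoinP/rpred_sum => i /AF/int_adjoinP. Qed.

Lemma adj_prod I (r : seq I) (P : pred I) F :
  (forall i, P i -> A (F i)) -> A (\prod_(i <- r | P i) F i).
Proof. by move=> AF; apply/int_adjoinP/rpred_prod => i /AF/int_adjoinP. Qed.

(** Subtraction and 1 generate the integers, and Horner's scheme then builds every value p(z). Many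
    properties of [A] can thus be checked at the generator [z] alone. *)
Lemma adj_ind (S : set algC) :
  S 1 -> S z -> (forall x y, A x -> A y -> S x -> S y -> S (x - y)) ->
  (forall x y, A x -> A y -> S x -> S y -> S (x * y)) -> A `<=` S.
Proof.
move=> S1 Sz SB SM.
have S0 : S 0 by rewrite -(subrr 1); apply: SB => //; exact: adj1.
have SN x : A x -> S x -> S (- x).
  by move=> Ax Sx; rewrite -sub0r; apply: SB => //; exact: adj0.
have SD x y : A x -> A y -> S x -> S y -> S (x + y).
  by move=> Ax Ay Sx Sy; rewrite -[y]opprK; apply: SB; auto; exact: adjN.
have Snat n : S n%:R.
  elim: n => // n IHn; rewrite -addn1 natrD.
  by apply: SD => //; [exact: adj_nat | exact: adj1].
have Sint n : S n%:~R.
  case: n => n; first exact: Snat.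
  by rewrite NegzE rmorphN; apply: SN; [exact: adj_nat | exact: Snat].
move=> _ [p ->]; elim/poly_ind: p => [|p c IHp]; first by rewrite rmorph0 horner0.
rewrite rmorphD rmorphM /= map_polyX map_polyC /= !hornerE.
have Ap : A (map_poly intr p).[z] by exists p.
by apply: SD; [apply: adjM => //; exact: adj_gen | exact: adj_int
  | apply: SM => //; exact: adj_gen |].
Qed.

(** * Ideals of Z[z]: congruences, products and scaling *)

Section Ideal.

Variables (I : set algC) (idI : is_ideal A I).

Lemma ideal_sub x : I x -> A x. Proof. by case: idI => sIA _ _ _; exact: sIA. Qed.
Lemma ideal0 : I 0. Proof. by case: idI. Qed.
Lemma idealD x y : I x -> I y -> I (x + y).
Proof. by case: idI => _ _ ID _; exact: ID. Qed.
Lemma idealMl a x : A a -> I x -> I (a * x).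
Proof. by case: idI => _ _ _; apply. Qed.
Lemma idealMr a x : A a -> I x -> I (x * a).
Proof. by rewrite mulrC; exact: idealMl. Qed.
Lemma idealN x : I x -> I (- x).
Proof. by move=> Ix; rewrite -mulN1r; apply: idealMl => //; exact/adjN/adj1. Qed.
Lemma idealB x y : I x -> I y -> I (x - y).
Proof. by move=> Ix Iy; apply: idealD => //; exact: idealN. Qed.
Lemma ideal_sum J (r : seq J) (P : pred J) F :
  (forall i, P i -> I (F i)) -> I (\sum_(i <- r | P i) F i).
Proof.
move=> IF; apply: big_ind => //; first exact: ideal0.
by move=> x y; exact: idealD.
Qed.
Lemma ideal_opp x : I (- x) -> I x.
Proof. by move=> /idealN; rewrite opprK. Qed.
Lemma ideal_subC x y : I (x - y) -> I (y - x).
Proof. by move=> /idealN; rewrite opprB. Qed.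
Lemma ideal_modl x y : I (x - y) -> I y -> I x.
Proof. by move=> Ixy Iy; rewrite -(subrK y x); exact: idealD. Qed.
Lemma ideal_modr x y : I (x - y) -> I x -> I y.
Proof. by move=> /ideal_subC; exact: ideal_modl. Qed.
Lemma ideal_mod_trans y x w : I (x - y) -> I (y - w) -> I (x - w).
Proof. by move=> Ixy /(idealD Ixy); rewrite addrA subrK. Qed.
Lemma ideal_modM x y x' y' : A x -> A y' ->
  I (x - x') -> I (y - y') -> I (x * y - x' * y').
Proof.
move=> Ax Ay' Ix Iy; rewrite -(subrK (x * y') (x * y)) -mulrBr -addrA -mulrBl.
by apply: idealD; [exact: idealMl | exact: idealMr].
Qed.
Lemma ideal_modX x y n : A x -> A y -> I (x - y) -> I (x ^+ n - y ^+ n).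
Proof.
move=> Ax Ay Ixy; elim: n => [|n IHn]; first by rewrite subrr; exact: ideal0.
by rewrite !exprS; apply: ideal_modM => //; exact: adjX.
Qed.
Lemma idealX x n : (0 < n)%N -> I x -> I (x ^+ n).
Proof.
case: n => // n _ Ix; rewrite exprS; apply: idealMr => //.
exact/adjX/ideal_sub.
Qed.
Lemma ideal_full : I 1 -> I = A.
Proof.
move=> I1; apply/seteqP; split=> x; first exact: ideal_sub.
by move=> Ax; rewrite -[x]mulr1; exact: idealMl.
Qed.

End Ideal.

Lemma is_ideal_full : is_ideal A A.
Proof. by split=> // *; [exact: adj0 | exact: adjD | exact: adjM]. Qed.

Lemma principal_is_ideal a : A a -> is_ideal A (principal_ideal A a).
Proof.
move=> Aa; split.
- by move=> _ [x Ax <-]; exact: adjM.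
- by exists 0; [exact: adj0 | rewrite mulr0].
- by move=> _ _ [x Ax <-] [y Ay <-]; exists (x + y); [exact: adjD | rewrite mulrDr].
- by move=> b _ Ab [x Ax <-]; exists (b * x); [exact: adjM | rewrite mulrCA].
Qed.

Lemma principal_self a : principal_ideal A a a.
Proof. by exists 1; [exact: adj1 | rewrite mulr1]. Qed.

Lemma principal_le I a : is_ideal A I -> I a -> principal_ideal A a `<=` I.
Proof. by move=> idI Ia _ [x Ax <-]; exact: idealMr. Qed.

Lemma scale_ideal c I : is_ideal A I -> (forall x, I x -> A (c * x)) ->
  is_ideal A (scale_set c I).
Proof.
move=> idI cIA; split.
- by move=> _ [x Ix <-]; exact: cIA.
- by exists 0; [exact: ideal0 | rewrite mulr0].
- by move=> _ _ [x Ix <-] [y Iy <-]; exists (x + y); [exact: idealD | rewrite mulrDr].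
- by move=> b _ Ab [x Ix <-]; exists (b * x); [exact: idealMl | rewrite mulrCA].
Qed.

Lemma prime_idealX P x n :
  is_prime_ideal A P -> A x -> P (x ^+ n) -> P x.
Proof.
move=> [idP PA prP] Ax; elim: n => [P1|n IHn].
  by case: PA; apply: ideal_full => //; rewrite -(expr0 x).
by rewrite exprS => /(prP _ _ Ax (adjX _ Ax))[].
Qed.

Lemma prime_ideal_proper P : is_prime_ideal A P -> ~ P 1.
Proof. by move=> [idP PA _] P1; apply: PA; exact: ideal_full. Qed.

Lemma prime_ideal_prod P (s : seq algC) :
  is_prime_ideal A P -> {in s, forall a, A a} -> P (\prod_(a <- s) a) ->
  exists2 a, a \in s & P a.
Proof.
move=> prP; have [_ _ PM] := prP.
elim: s => [_|a s IHs sA]; first by rewrite big_nil => /(prime_ideal_proper prP).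
have sA' : {in s, forall b, A b} by move=> b sb; apply: sA; rewrite inE sb orbT.
rewrite big_cons => /PM[||Pa|/(IHs sA')[b sb Pb]].
- by apply: sA; rewrite mem_head.
- by rewrite big_seq; apply: adj_prod => b; exact: sA'.
- by exists a; rewrite ?mem_head.
- by exists b; rewrite // inE sb orbT.
Qed.

Lemma ideal_mul_in I J x y : I x -> J y -> ideal_mul I J (x * y).
Proof.
move=> Ix Jy; exists 1%N, (fun=> x), (fun=> y).
by split=> //; rewrite big_ord1.
Qed.

Lemma ideal_mul0 I J : ideal_mul I J 0.
Proof.
exists 0%N, (fun=> 0), (fun=> 0).
by split=> [[]|[]|] //; rewrite big_ord0.
Qed.

Lemma ideal_mulD I J x y :
  ideal_mul I J x -> ideal_mul I J y -> ideal_mul I J (x + y).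
Proof.
move=> [n [a [b [Ia Jb ->]]]] [n' [a' [b' [Ia' Jb' ->]]]].
exists (n + n')%N.
exists (fun i => match fintype.split i with inl j => a j | inr j => a' j end).
exists (fun i => match fintype.split i with inl j => b j | inr j => b' j end).
split=> [i|i|]; [by case: (fintype.split i) | by case: (fintype.split i) |].
rewrite big_split_ord /=; congr (_ + _); apply: eq_bigr => i _.
  by rewrite (unsplitK (inl i)).
by rewrite (unsplitK (inr i)).
Qed.

Lemma ideal_mul_ind I J (S : set algC) :
  S 0 -> (forall x y, S x -> S y -> S (x + y)) ->
  (forall x y, I x -> J y -> S (x * y)) -> ideal_mul I J `<=` S.
Proof.
move=> S0 SD SM x [n [a [b [Ia Jb ->]]]]; apply: big_ind => // i _; exact: SM.
Qed.

Lemma ideal_mulC I J : ideal_mul I J = ideal_mul J I.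
Proof.
by apply/seteqP; split; apply: ideal_mul_ind;
  [exact: ideal_mul0 | exact: ideal_mulD |
   move=> x y Ix Jy; rewrite mulrC; exact: ideal_mul_in |
   exact: ideal_mul0 | exact: ideal_mulD |
   move=> x y Ix Jy; rewrite mulrC; exact: ideal_mul_in ].
Qed.

Lemma ideal_mulA I J K : ideal_mul I (ideal_mul J K) = ideal_mul (ideal_mul I J) K.
Proof.
apply/seteqP; split; apply: ideal_mul_ind; try exact: ideal_mul0;
  try exact: ideal_mulD.
- move=> x y Ix; move: y; apply: ideal_mul_ind.
  + by rewrite mulr0; exact: ideal_mul0.
  + by move=> u v; rewrite mulrDr; exact: ideal_mulD.
  + by move=> u v Ju Kv; rewrite mulrA; do 2?apply: ideal_mul_in.
- move=> x y /[swap] Ky; move: x; apply: ideal_mul_ind.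
  + by rewrite mul0r; exact: ideal_mul0.
  + by move=> u v; rewrite mulrDl; exact: ideal_mulD.
  + by move=> u v Iu Jv; rewrite -mulrA; do 2?apply: ideal_mul_in.
Qed.

Lemma is_ideal_mul I J : is_ideal A I -> is_ideal A J -> is_ideal A (ideal_mul I J).
Proof.
move=> idI idJ; split.
- apply: ideal_mul_ind; [exact: adj0 | by move=> *; exact: adjD |].
  by move=> x y Ix Jy; apply: adjM; [exact: (ideal_sub idI) | exact: (ideal_sub idJ)].
- exact: ideal_mul0.
- by move=> x y; exact: ideal_mulD.
- move=> a x Aa; move: x; apply: ideal_mul_ind.
  + by rewrite mulr0; exact: ideal_mul0.
  + by move=> x y; rewrite mulrDr; exact: ideal_mulD.
  + by move=> x y Ix Jy; rewrite mulrA; apply: ideal_mul_in => //; exact: idealMl.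
Qed.

Lemma ideal_mul1 I : is_ideal A I -> ideal_mul A I = I.
Proof.
move=> idI; apply/seteqP; split.
  apply: ideal_mul_ind; [exact: ideal0|by move=> *; exact: idealD|].
  by move=> x y Ax Iy; exact: idealMl.
by move=> x Ix; rewrite -[x]mul1r; apply: ideal_mul_in => //; exact: adj1.
Qed.

Lemma scale_mul a I J : scale_set a (ideal_mul I J) = ideal_mul (scale_set a I) J.
Proof.
apply/seteqP; split.
  move=> _ [x + <-]; move: x; apply: ideal_mul_ind.
  + by rewrite mulr0; exact: ideal_mul0.
  + by move=> x y; rewrite mulrDr; exact: ideal_mulD.
  + by move=> x y Ix Jy; rewrite mulrA; apply: ideal_mul_in => //; exists x.
apply: ideal_mul_ind; first by exists 0; [exact: ideal_mul0|rewrite mulr0].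
- move=> _ _ [x Hx <-] [y Hy <-]; exists (x + y); last by rewrite mulrDr.
  exact: ideal_mulD.
- move=> _ y [x Ix <-] Jy; exists (x * y); last by rewrite mulrA.
  exact: ideal_mul_in.
Qed.

Lemma scale_mulr a I J : scale_set a (ideal_mul I J) = ideal_mul I (scale_set a J).
Proof. by rewrite ideal_mulC scale_mul ideal_mulC. Qed.

Lemma scale_scale a b I : scale_set a (scale_set b I) = scale_set (a * b) I.
Proof.
apply/seteqP; split=> [_ [_ [x Ix <-] <-]|_ [x Ix <-]].
  by exists x; rewrite ?mulrA.
by exists (b * x); [exists x | rewrite mulrA].
Qed.

Lemma scale1 I : scale_set 1 I = I.
Proof.
apply/seteqP; split=> [_ [x Ix <-]|x Ix]; first by rewrite mul1r.
by exists x; rewrite ?mul1r.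
Qed.

Lemma scale_le a I J : a != 0 -> scale_set a I `<=` scale_set a J -> I `<=` J.
Proof.
by move=> a0 sIJ x Ix; have [|y Jy /(mulfI a0) <-] := sIJ (a * x); first exists x.
Qed.

Lemma scaleI a I J : a != 0 -> scale_set a I = scale_set a J -> I = J.
Proof.
move=> a0 e; apply/seteqP; split; apply: (scale_le a0); rewrite e //.
Qed.

Lemma principal_mul a I : is_ideal A I ->
  ideal_mul (principal_ideal A a) I = scale_set a I.
Proof. by move=> idI; rewrite -scale_mul ideal_mul1. Qed.

Lemma ideal_mul_full I J : is_ideal A I -> is_ideal A J ->
  ideal_mul I J = A -> I = A.
Proof.
move=> idI idJ e; apply: ideal_full => //.
have : ideal_mul I J 1 by rewrite e; exact: adj1.
move: 1; apply: ideal_mul_ind; [exact: ideal0|by move=> *; exact: idealD|].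
by move=> x y Ix Jy; apply: idealMr => //; exact: (ideal_sub idJ).
Qed.

(** The fractional ideals a^-1 I and b^-1 J lie in [A] and their product is [A], so the first of
    them is [A]. *)
Lemma factor_principal I J a b : is_ideal A I -> is_ideal A J ->
  a != 0 -> b != 0 ->
  (forall x, I x -> A (a^-1 * x)) -> (forall x, J x -> A (b^-1 * x)) ->
  ideal_mul I J = principal_ideal A (a * b) ->
  I = principal_ideal A a.
Proof.
move=> idI idJ a0 b0 IA JA e; apply: (@scaleI a^-1); rewrite ?invr_eq0 //.
rewrite /principal_ideal scale_scale mulVf // scale1.
apply: (@ideal_mul_full _ (scale_set b^-1 J)); try exact: scale_ideal.
rewrite -scale_mul -scale_mulr e /principal_ideal !scale_scale.
by rewrite -invfM mulVf ?mulf_neq0 // scale1.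
Qed.

End IntAdjoin.

(** * The Galois group of the cyclotomic field, and the norm *)

Section Galois.

Variables (m : nat) (z : algC).
Hypotheses (m_gt1 : (1 < m)%N) (z_prim : m.-primitive_root z).
Local Notation A := (int_adjoin z).

Lemma adj_horner (p : {poly int}) y : A y -> A (map_poly intr p).[y].
Proof.
move=> Ay; rewrite horner_coef; apply: adj_sum => i _.
by rewrite coef_map; apply: adjM; [exact: adj_int | exact: adjX].
Qed.

(** Euclidean division by the monic cyclotomic polynomial, which has degree totient m and vanishes
    at [z]. *)
Lemma adj_reduce x : A x ->
  exists2 r : {poly int}, (size r <= totient m)%N & x = (map_poly intr r).[z].
Proof.
move=> [p ->]; have monPhi := Cyclotomic_monic m.
exists (Pdiv.Ring.rmodp p 'Phi_m).
  by rewrite -ltnS -size_Cyclotomic Pdiv.Ring.ltn_rmodpN0 // monic_neq0.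
rewrite {1}(Pdiv.RingMonic.rdivp_eq monPhi p) rmorphD rmorphM /=.
rewrite (Cintr_Cyclotomic z_prim) !hornerE.
have /eqP-> : root (cyclotomic z m) z by rewrite root_cyclotomic.
by rewrite mulr0 add0r.
Qed.

Lemma adj_Aint x : A x -> x \in Aint.
Proof.
move: x; apply: adj_ind => [||x y _ _|x y _ _].
- exact: rpred1.
- exact: Aint_prim_root z_prim.
- exact: rpredB.
- exact: rpredM.
Qed.

Lemma aut_horner (f : {rmorphism algC -> algC}) (p : {poly int}) y :
  f (map_poly intr p).[y] = (map_poly intr p).[f y].
Proof.
rewrite -horner_map /= -map_poly_comp; congr (_.[_]).
by apply: eq_map_poly => n /=; rewrite rmorph_int.
Qed.

Lemma aut_adj (f : {rmorphism algC -> algC}) x : A (f z) -> A x -> A (f x).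
Proof. by move=> Afz [p ->]; rewrite aut_horner; exact: adj_horner. Qed.

Lemma eq_aut_adj (f g : {rmorphism algC -> algC}) x : f z = g z -> A x -> f x = g x.
Proof. by move=> fg [p ->]; rewrite !aut_horner fg. Qed.

Local Notation U := {unit 'Z_m}.

Lemma modn_Zp k : (k %% (Zp_trunc m).+2 = k %% m)%N.
Proof. by rewrite Zp_cast. Qed.

Lemma unit_coprime (u : U) : coprime (val u : 'Z_m) m.
Proof.
by rewrite coprime_sym -unitZpE // natr_Zp; exact: valP.
Qed.

(** An automorphism of all of [algC] picked from an existence statement; [u] pins it down on [A],
    whence the membership hypotheses in [galM] and [gal1]. *)
Definition gal (u : U) : {rmorphism algC -> algC} :=
  sval (Qn_aut_exists (unit_coprime u)).

Lemma gal_gen u : gal u z = z ^+ (val u : 'Z_m).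
Proof.
by rewrite /gal; case: (Qn_aut_exists _) => f /= -> //; exact: prim_expr_order.
Qed.

Lemma gal_adj u x : A x -> A (gal u x).
Proof. by apply: aut_adj; rewrite gal_gen; exact/adjX/adj_gen. Qed.

Lemma galM u v x : A x -> gal u (gal v x) = gal (u * v)%g x.
Proof.
apply: (eq_aut_adj (f := gal u \o gal v)) => /=.
rewrite !gal_gen rmorphXn /= gal_gen -exprM -[RHS](prim_expr_mod z_prim).
by rewrite -[LHS](prim_expr_mod z_prim) /= modn_Zp modn_mod.
Qed.

Lemma gal1 x : A x -> gal 1%g x = x.
Proof.
apply: (eq_aut_adj (g := idfun)) => /=.
by rewrite gal_gen /= expr1.
Qed.

Lemma gal_exists k : coprime k m ->
  exists u : U, (val u : 'Z_m) = k%:R /\ gal u z = z ^+ k.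
Proof.
move=> co_k; have Uk : (k%:R : 'Z_m) \is a GRing.unit.
  by rewrite unitZpE // coprime_sym.
exists (FinRing.unit 'Z_m Uk); split=> //.
by rewrite gal_gen /= val_Zp_nat // prim_expr_mod.
Qed.

Lemma card_unit_Zm : #|{: U}| = totient m.
Proof. by rewrite -card_units_Zp ?(ltnW m_gt1) // cardsT. Qed.

(** Write y = r(z) with r of degree below totient m. As y is fixed, r - y vanishes at all totient m
    conjugates of z, so it is zero and y is the constant coefficient of r. *)
Lemma gal_fixed_int y : A y -> (forall u, gal u y = y) ->
  exists n : int, y = n%:~R.
Proof.
move=> Ay fix_y; have [r sz_r def_y] := adj_reduce Ay.
pose g := map_poly intr r - y%:P.
have [/eqP g0|g_neq0] := eqVneq g 0.
  exists r`_0; move: g0; rewrite subr_eq0 => /eqP/(congr1 (fun p : {poly _} => p`_0)).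
  by rewrite coef_map coefC /= => ->.
pose rs := [seq z ^+ (val u : 'Z_m) | u : U].
have uniq_rs : uniq rs.
  rewrite map_inj_uniq ?enum_uniq // => u v /eqP.
  rewrite (eq_prim_root_expr z_prim) => /eqP uv; apply/val_inj/val_inj.
  move: uv; rewrite -!modn_Zp !modn_small //; exact: ltn_ord.
have root_rs : all (root g) rs.
  apply/allP=> _ /mapP[u _ ->]; rewrite rootE !hornerE -gal_gen -aut_horner.
  by rewrite -def_y fix_y subrr.
have := max_poly_roots g_neq0 root_rs uniq_rs.
rewrite size_map -cardE card_unit_Zm ltnNge => /negP[].
rewrite (leq_trans (size_polyD _ _)) // size_polyN geq_max.
rewrite size_map_inj_poly ?sz_r //=; last exact: intr_inj.
by rewrite (leq_trans (size_polyC_leq1 _)) // totient_gt0 ltnW.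
Qed.

Definition adj_norm x := \prod_(u : U) gal u x.

Lemma adj_norm_int x : A x -> exists n : int, adj_norm x = n%:~R.
Proof.
move=> Ax; apply: gal_fixed_int => [|u].
  by apply: adj_prod => u _; exact: gal_adj.
rewrite /adj_norm rmorph_prod [RHS](reindex_inj (mulgI u)) /=.
by apply: eq_bigr => v _; rewrite galM.
Qed.

Lemma adj_norm_dvd x : A x -> principal_ideal A x (adj_norm x).
Proof.
move=> Ax; rewrite /adj_norm (bigD1 1%g) //= gal1 //.
eexists; last by [].
by apply: adj_prod => u _; exact: gal_adj.
Qed.

(** The integer is the absolute value of the norm of x. Consequently every nonzero ideal contains a
    positive integer. *)
Lemma adj_dvd_nat x : A x -> x != 0 ->
  exists2 n : nat, (0 < n)%N & principal_ideal A x n%:R.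
Proof.
move=> Ax x0; have idx := principal_is_ideal Ax.
have [n def_n] := adj_norm_int Ax; exists `|n|%N.
  rewrite absz_gt0 -(intr_eq0 algC) -def_n.
  by apply/prodf_neq0 => u _; rewrite fmorph_eq0.
have := adj_norm_dvd Ax; rewrite def_n; case: (intP n) => // k.
by rewrite rmorphN abszN => /(ideal_opp idx).
Qed.

End Galois.

(** * Frobenius power maps modulo divisors of rational primes *)

Definition frob_periodic (z a : algC) : Prop :=
  [/\ int_adjoin z a, a != 0
    & exists2 N, (1 < N)%N
      & forall y, int_adjoin z y ->
          principal_ideal (int_adjoin z) a (y ^+ N - y)].

Section Frobenius.

Variables (m : nat) (z : algC).
Hypotheses (m_gt1 : (1 < m)%N) (z_prim : m.-primitive_root z).
Local Notation A := (int_adjoin z).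

Section FrobeniusMod.

Variables (p : nat) (a : algC).
Hypotheses (p_prime : prime p) (Aa : A a) (a_dvd_p : principal_ideal A a p%:R).
Let ida := principal_is_ideal Aa.

Lemma frobD x y : A x -> A y ->
  principal_ideal A a ((x + y) ^+ p - (x ^+ p + y ^+ p)).
Proof.
move=> Ax Ay.
have {1}-> : ((x + y) ^+ p = x ^+ p + y ^+ p +
    \sum_(i < p.-1) x ^+ (p - i.+1) * y ^+ i.+1 *+ 'C(p, i.+1))%R.
  rewrite exprDn -(prednK (prime_gt0 p_prime)) big_ord_recl big_ord_recr /=.
  rewrite subn0 bin0 expr0 mulr1 mulr1n /bump /= !add1n subnn binn expr0 mul1r.
  by rewrite mulr1n -[RHS]addrA [X in _ = _ + X]addrC.
rewrite addrAC subrr add0r; apply: (ideal_sum ida) => i _.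
have /dvdnP[c ->] : (p %| 'C(p, i.+1))%N.
  by apply: prime_dvd_bin => //; rewrite -ltn_predRL /=.
rewrite mulrnA -mulr_natr; apply: (idealMl ida) => //.
by rewrite -mulr_natr; do 2?apply: adjM; [exact: adjX|exact: adjX|exact: adj_nat].
Qed.

Lemma frobXD s x y : A x -> A y ->
  principal_ideal A a ((x + y) ^+ (p ^ s) - (x ^+ (p ^ s) + y ^+ (p ^ s))).
Proof.
move=> Ax Ay; elim: s => [|s IHs]; first by rewrite !expr1 subrr; exact: (ideal0 ida).
rewrite expnSr !exprM.
apply: (ideal_mod_trans ida (y := (x ^+ (p ^ s) + y ^+ (p ^ s)) ^+ p)).
  by apply: (ideal_modX ida) => //; [exact/adjX/adjD | apply: adjD; exact: adjX].
by apply: frobD; exact: adjX.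
Qed.

(* The elements on which [f] agrees with the [p ^ s]-power map modulo [a] form a
   subring, so it suffices to look at the generator [z]. *)
Lemma frob_mod (f : {rmorphism algC -> algC}) s :
  principal_ideal A a (f z - z ^+ (p ^ s)) ->
  forall x, A x -> principal_ideal A a (f x - x ^+ (p ^ s)).
Proof.
move=> fz.
have Af x : A x -> principal_ideal A a (f x - x ^+ (p ^ s)) -> A (f x).
  move=> Ax /(ideal_sub ida) Afx; rewrite -(subrK (x ^+ (p ^ s)) (f x)).
  by apply: adjD => //; exact: adjX.
apply: adj_ind => //.
- by rewrite rmorph1 expr1n subrr; exact: (ideal0 ida).
- move=> x y Ax Ay fx fy; rewrite rmorphB.
  have := frobXD s (adjB Ax Ay) Ay; rewrite subrK => xy.
  have := idealD ida (idealB ida fx fy) xy.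
  set u := x ^+ _; set v := y ^+ _; set w := (x - y) ^+ _.
  suff -> : f x - f y - w = f x - u - (f y - v) + (u - (w + v)) by [].
  by rewrite !opprD !opprK !addrA; ring.
- move=> x y Ax Ay fx fy; rewrite rmorphM exprMn.
  by apply: (ideal_modM ida) => //; [exact: Af | exact: adjX].
Qed.

End FrobeniusMod.

(** The case of [frob_mod] where the automorphism is the identity: a Frobenius power that fixes [z]
    modulo [a] fixes all of [A] modulo [a]. *)
Lemma frob_periodic_gen p a s : prime p -> (0 < s)%N -> A a -> a != 0 ->
  principal_ideal A a p%:R -> principal_ideal A a (z ^+ (p ^ s) - z) ->
  frob_periodic z a.
Proof.
move=> p_pr s_gt0 Aa a0 ap az; have ida := principal_is_ideal Aa.
split=> //; exists (p ^ s)%N.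
  by rewrite -(exp1n s) ltn_exp2r // prime_gt1.
move=> y Ay; apply: (ideal_subC ida).
by apply: (frob_mod p_pr Aa ap (f := idfun)) => //=; exact: (ideal_subC ida).
Qed.

(** By Euler's theorem p ^ totient m is 1 modulo m, so raising to this power leaves z itself
    unchanged. *)
Lemma frob_periodic_coprime p : prime p -> coprime p m -> frob_periodic z p%:R.
Proof.
move=> p_pr co_pm; have Ap := adj_nat z p.
apply: (@frob_periodic_gen p _ (totient m)) => //.
- by rewrite totient_gt0 ltnW.
- by rewrite pnatr_eq0 -lt0n prime_gt0.
- exact: principal_self.
- suff -> : z ^+ (p ^ totient m) = z.
    by rewrite subrr; exact: (ideal0 (principal_is_ideal Ap)).
  rewrite -[RHS]expr1; apply/eqP; rewrite (eq_prim_root_expr z_prim).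
  exact/eqP/Euler_exp_totient.
Qed.

Definition frob_product (x : algC) :=
  exists2 s : seq algC, {in s, forall a, frob_periodic z a} & x = \prod_(a <- s) a.

Lemma frob_product1 : frob_product 1.
Proof. by exists [::] => //; rewrite big_nil. Qed.

Lemma frob_productM x y : frob_product x -> frob_product y -> frob_product (x * y).
Proof.
move=> [s ss ->] [s' ss' ->]; exists (s ++ s'); last by rewrite big_cat.
by move=> a; rewrite mem_cat => /orP[/ss|/ss'].
Qed.

Lemma frob_product_self a : frob_periodic z a -> frob_product a.
Proof.
by move=> ga; exists [:: a]; rewrite ?big_seq1 // => b /[!inE] /eqP->.
Qed.

(** Modulo a unit every congruence holds. The element -1 absorbs the sign in
    [prod_sub_root_unity]. *)
Lemma frob_periodicN1 : frob_periodic z (-1).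
Proof.
split; [exact/adjN/adj1 | by rewrite oppr_eq0 oner_eq0 |].
exists 2%N => // y Ay; exists (- (y ^+ 2 - y)); last by rewrite mulN1r opprK.
by apply/adjN/adjB => //; exact: adjX.
Qed.

Lemma dvd_prod (J : eqType) (r : seq J) (F : J -> algC) i :
  i \in r -> (forall j, j \in r -> A (F j)) ->
  principal_ideal A (F i) (\prod_(j <- r) F j).
Proof.
move=> ir AF; rewrite (big_rem i) //=; eexists; last by [].
by rewrite big_seq; apply: adj_prod => j /mem_rem; exact: AF.
Qed.

Lemma principal_trans a b c : A b ->
  principal_ideal A a b -> principal_ideal A b c -> principal_ideal A a c.
Proof. by move=> Ab [x Ax <-] [y Ay <-]; exists (x * y); [exact: adjM|rewrite mulrA]. Qed.

(** * Primes dividing m: factorization into differences of p-power roots of unity *)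

Section Ramified.

Variables (p k n : nat) (w : algC).
Hypotheses (p_prime : prime p) (co_pn : coprime p n) (m_pkn : m = (n * p ^ k.+1)%N).
Hypothesis def_w : w = z ^+ n.

Let w_prim : (p ^ k.+1).-primitive_root w.
Proof.
have -> : w = z ^+ (m %/ p ^ k.+1).
  by rewrite def_w m_pkn mulnK // expn_gt0 prime_gt0.
by apply: dvdn_prim_root => //; rewrite m_pkn dvdn_mull.
Qed.

Let eta_prim : p.-primitive_root (w ^+ (p ^ k)).
Proof.
have -> : (p ^ k = p ^ k.+1 %/ p)%N by rewrite expnSr mulnK // prime_gt0.
by apply: dvdn_prim_root => //; rewrite expnS dvdn_mulr.
Qed.

Let rho_prim : (p ^ k).-primitive_root (w ^+ p).
Proof.
have := dvdn_prim_root w_prim (dvdn_exp2l p (leqnSn k)).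
by rewrite expnS mulnK // expn_gt0 prime_gt0.
Qed.

Let Aw : A w. Proof. by rewrite def_w; exact/adjX/adj_gen. Qed.

(** Evaluate 1 + X + ... + X^(p-1) = prod (X - eta^i) at 1, where eta = w^(p^k) is a primitive p-th
    root of unity. *)
Lemma prod_sub_root_unity_prime :
  p%:R = \prod_(i <- index_iota 1 p) (1 - (w ^+ (p ^ k)) ^+ i).
Proof.
have := factor_Xn_sub_1 eta_prim; rewrite big_ltn ?prime_gt0 // expr0 subrX1.
have nz : 'X - 1%:P != 0 :> {poly algC} by rewrite polyXsubC_eq0.
move/(mulfI nz)/(congr1 (fun q => q.[1])).
rewrite horner_prod horner_sum => e.
rewrite -[RHS]/(\prod_(1 <= i < p) _).
under eq_bigr => i _ do rewrite -[1 - _]hornerXsubC.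
rewrite e; under eq_bigr do rewrite hornerXn expr1n.
by rewrite sumr_const card_ord.
Qed.

(** Evaluate X^(p^k) - 1 = prod (X - rho^j) at w^i, where rho = w^p is a primitive p^k-th root of
    unity. *)
Lemma prod_sub_root_unity i :
  1 - (w ^+ (p ^ k)) ^+ i =
  -1 * \prod_(j <- index_iota 0 (p ^ k)) (w ^+ i - (w ^+ p) ^+ j).
Proof.
have := factor_Xn_sub_1 rho_prim => /(congr1 (fun q => q.[w ^+ i])).
rewrite horner_prod => e; rewrite -[\prod_(j <- _) _]/(\prod_(0 <= j < p ^ k) _).
under [in RHS]eq_bigr => j _ do rewrite -[_ - _]hornerXsubC.
by rewrite e !hornerE mulN1r opprB -!exprM mulnC.
Qed.

(** Modulo such a difference p vanishes and w = z^n becomes 1. As p ^ totient n is 1 modulo n, that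
    power map fixes z. *)
Lemma frob_periodic_ramified i j : (0 < i < p)%N -> (j < p ^ k)%N ->
  frob_periodic z (w ^+ i - (w ^+ p) ^+ j).
Proof.
move=> /andP[i_gt0 i_lt_p] j_lt; set a := _ - _.
have Aa : A a by apply: adjB; do 2?apply: adjX.
have ida := principal_is_ideal Aa.
have pk_gt0 : (0 < p ^ k.+1)%N by rewrite expn_gt0 prime_gt0.
have n_gt0 : (0 < n)%N by move: m_gt1; rewrite m_pkn; case: (n).
have ap : principal_ideal A a p%:R.
  rewrite prod_sub_root_unity_prime.
  have Aeta l : A (1 - (w ^+ (p ^ k)) ^+ l).
    by apply: adjB; [exact: adj1 | do 2?apply: adjX].
  apply: (@principal_trans _ (1 - (w ^+ (p ^ k)) ^+ i)) => //; last first.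
    apply: (dvd_prod (F := fun l => 1 - (w ^+ (p ^ k)) ^+ l)) => //.
    by rewrite mem_index_iota i_gt0.
  rewrite prod_sub_root_unity; apply: (idealMl ida); first exact/adjN/adj1.
  apply: (dvd_prod (F := fun j => w ^+ i - (w ^+ p) ^+ j)).
    by rewrite mem_index_iota.
  by move=> l _; apply: adjB; do 2?apply: adjX.
have a0 : a != 0.
  apply: contraL (prime_gt0 p_prime) => /eqP a0; move: ap; rewrite a0.
  by move=> [y _ /esym/eqP]; rewrite mul0r pnatr_eq0 => /eqP->.
(* Modulo [a] the power [w ^+ l] is 1, where [l] is prime to [p]; hence so is [w]. *)
pose l := (i + (p ^ k.+1 * j - p * j))%N.
(* Multiplying [a] by this power of w turns w^(p j) into w^(p^(k+1) j) = 1 and w^i into w^l. *)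
have wl : principal_ideal A a (w ^+ l - 1).
  exists (w ^+ (p ^ k.+1 * j - p * j)); first exact: adjX.
  rewrite mulrBl -!exprM -!exprD subnKC; last first.
    by rewrite leq_mul2r -{1}(expn1 p) leq_exp2l ?orbT // prime_gt1.
  by rewrite [w ^+ (_ * j)]exprM (prim_expr_order w_prim) expr1n.
have w1 : principal_ideal A a (w - 1).
  have co_l : coprime l (p ^ k.+1).
    rewrite coprime_pexpr // coprime_sym prime_coprime // /l expnS -mulnA -mulnBr.
    by rewrite dvdn_addl ?dvdn_mulr // gtnNdvd.
  have T_gt0 : (0 < totient (p ^ k.+1))%N by rewrite totient_gt0.
  (* The outer exponent is the inverse of l modulo p^(k+1) given by Euler's theorem. *)
  have -> : w = (w ^+ l) ^+ (l ^ (totient (p ^ k.+1)).-1).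
    rewrite -exprM -expnS prednK // -[LHS]expr1; apply/eqP.
    rewrite (eq_prim_root_expr w_prim) eq_sym; exact/eqP/Euler_exp_totient.
  rewrite -[X in _ - X](expr1n _ (l ^ (totient (p ^ k.+1)).-1)).
  by apply: (ideal_modX ida); [exact: adjX|exact: adj1|].
apply: (@frob_periodic_gen p _ (totient n)); rewrite ?totient_gt0 //.
have pT_gt0 : (0 < p ^ totient n)%N by rewrite expn_gt0 prime_gt0.
have /dvdnP[c def_c] : (n %| p ^ totient n - 1)%N.
  by rewrite -eqn_mod_dvd //; exact/eqP/Euler_exp_totient.
have -> : z ^+ (p ^ totient n) - z = z * (w ^+ c - 1).
  by rewrite -(subnKC pT_gt0) def_c mulnC exprD expr1 exprM -def_w mulrBr mulr1.
apply: (idealMl ida); first exact: adj_gen.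
by rewrite -[X in _ - X](expr1n _ c); apply: (ideal_modX ida); [|exact: adj1|].
Qed.

Lemma frob_product_ramified : frob_product p%:R.
Proof.
rewrite prod_sub_root_unity_prime big_seq.
apply: big_ind => [||i]; [exact: frob_product1|exact: frob_productM|].
rewrite mem_index_iota prod_sub_root_unity => i_p.
apply: frob_productM; first exact/frob_product_self/frob_periodicN1.
rewrite big_seq; apply: big_ind => [||j]; [exact: frob_product1|exact: frob_productM|].
rewrite mem_index_iota => /andP[_ j_lt].
exact/frob_product_self/frob_periodic_ramified.
Qed.

End Ramified.

End Frobenius.

(** * Z[z] is the full ring of integers *)

Section Integral.

Variables (m : nat) (z : algC).
Hypotheses (m_gt1 : (1 < m)%N) (z_prim : m.-primitive_root z).
Local Notation A := (int_adjoin z).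

Lemma frob_product_prime p : prime p -> frob_product z p%:R.
Proof.
move=> p_pr; have [co_pm|] := boolP (coprime p m).
  exact/frob_product_self/(frob_periodic_coprime m_gt1 z_prim).
rewrite prime_coprime // negbK => p_dvd_m.
have m_gt0 : (0 < m)%N := ltnW m_gt1.
have [n co_pn def_m] := pfactor_coprime p_pr m_gt0.
have : (0 < logn p m)%N by rewrite logn_gt0 mem_primes p_pr m_gt0.
case: (logn p m) def_m => // k def_m _.
exact: (frob_product_ramified m_gt1 z_prim p_pr co_pn def_m).
Qed.

Lemma frob_periodic_iter a N y k : A a ->
  (forall y, A y -> principal_ideal A a (y ^+ N - y)) -> A y ->
  principal_ideal A a (y ^+ (N ^ k) - y).
Proof.
move=> Aa aN Ay; have ida := principal_is_ideal Aa.
elim: k => [|k IHk]; first by rewrite expr1 subrr; exact: (ideal0 ida).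
rewrite expnSr exprM.
apply: (ideal_mod_trans ida (y := y ^+ (N ^ k))) => //.
by apply: aN; exact: adjX.
Qed.

(** Modulo a, y is congruent to y ^ (N ^ n), a multiple of y ^ n because N ^ n > n. *)
Lemma frob_periodic_reduced a y n : frob_periodic z a -> A y ->
  principal_ideal A a (y ^+ n) -> principal_ideal A a y.
Proof.
move=> [Aa a0 [N N_gt1 aN]] Ay ayn; have ida := principal_is_ideal Aa.
apply: (ideal_modr ida (frob_periodic_iter n Aa aN Ay)).
rewrite -(subnKC (ltnW (ltn_expl n N_gt1))) exprD.
by apply: (idealMr ida) => //; exact: adjX.
Qed.

(** Multiply the monic integral equation of y = x / a, of degree d, by a^d: x^d becomes a
    combination of the x^i a^(d-i) with i < d, all divisible by a. Reducedness modulo a then gives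
    x. *)
Lemma frob_periodic_integral a x : frob_periodic z a -> A x ->
  x / a \in Aint -> principal_ideal A a x.
Proof.
move=> ga Ax; have [Aa a0 _] := ga; have ida := principal_is_ideal Aa.
rewrite unfold_in => /polyOverP int_P.
set y := x / a in int_P *; set P := minCpoly y in int_P *.
have monP : P \is monic := minCpoly_monic y.
have /eqP := root_minCpoly y; rewrite -/P horner_coef.
have szP : size P = (size P).-1.+1 by rewrite prednK // size_poly_gt0 monic_neq0.
set d := (size P).-1 in szP; rewrite szP big_ord_recr /=.
have -> : P`_d = 1 by rewrite -(monicP monP).
rewrite mul1r addrC => /eqP; rewrite addr_eq0 => /eqP yd.
apply: (@frob_periodic_reduced _ _ d) => //.
have def_x : x = a * y by rewrite /y mulrCA divff ?mulr1.
rewrite {1}def_x exprMn yd mulrN; apply: (idealN ida).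
rewrite mulr_sumr; apply: (ideal_sum ida) => i _.
have /intrP[c ->] := int_P i.
have -> : a ^+ d * (c%:~R * y ^+ i) = c%:~R * (x ^+ i * a ^+ (d - i)).
  rewrite def_x [(a * y) ^+ i]exprMn -{1}(subnK (ltnW (ltn_ord i))) exprD.
  by rewrite mulrCA; congr (_ * _); rewrite -mulrA mulrC.
apply: (idealMl ida); first exact: adj_int.
apply: (idealMl ida); first exact: adjX.
by apply: (idealX ida); [rewrite subn_gt0 | exact: principal_self].
Qed.

Lemma frob_product_integral a x : frob_product z a -> A x ->
  x / a \in Aint -> principal_ideal A a x.
Proof.
move=> [s ss ->]; elim: s x ss => [|b s IHs] x ss Ax.
  by move=> _; exists x; rewrite // big_nil mul1r.
rewrite big_cons => xbs.
have gb : frob_periodic z b by apply: ss; rewrite mem_head.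
have ss' : {in s, forall a, frob_periodic z a}.
  by move=> c sc; apply: ss; rewrite inE sc orbT.
have [Ab b0 _] := gb.
have s0 : \prod_(c <- s) c != 0.
  by rewrite prodf_seq_neq0; apply/allP=> c /ss'[].
have [y Ay def_x] : principal_ideal A b x.
  apply: frob_periodic_integral => //.
  have -> : x / b = x / (b * \prod_(c <- s) c) * \prod_(c <- s) c.
    by rewrite invfM mulrA mulfVK.
  apply: rpredM => //; apply: (adj_Aint z_prim); rewrite big_seq.
  by apply: adj_prod => c /ss'[].
have [||w Aw def_y] := IHs y ss' => //.
  by move: xbs; rewrite -def_x -mulf_div divff // mul1r.
by exists w; rewrite // -mulrA def_y.
Qed.

(** Induction on n: the least prime factor p of n is a product of periodic elements, so p divides x,
    and the quotient is treated with n / p. *)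
Lemma adj_integral_nat n x : (0 < n)%N -> A x -> x / n%:R \in Aint ->
  principal_ideal A n%:R x.
Proof.
elim/ltn_ind: n x => n IHn x n_gt0 Ax xn.
have [n_le1|n_gt1] := leqP n 1.
  by exists x; rewrite // (@anti_leq n 1) ?n_le1 // mul1r.
have p_pr := pdiv_prime n_gt1; set p := pdiv n in p_pr.
have def_n : n = (p * (n %/ p))%N by rewrite mulnC divnK // pdiv_dvd.
have en : n%:R = p%:R * (n %/ p)%:R :> algC by rewrite -natrM -def_n.
have p0 : p%:R != 0 :> algC by rewrite pnatr_eq0 -lt0n prime_gt0.
have n'_gt0 : (0 < n %/ p)%N.
  by move: n_gt0; rewrite {1}def_n; case: (_ %/ _)%N; rewrite ?muln0.
have n'0 : (n %/ p)%:R != 0 :> algC by rewrite pnatr_eq0 -lt0n.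
have [y Ay def_x] : principal_ideal A p%:R x.
  apply: frob_product_integral => //; first exact: frob_product_prime.
  have -> : x / p%:R = x / n%:R * (n %/ p)%:R.
    by rewrite en invfM mulrA mulfVK.
  by apply: rpredM => //; exact: rpred_nat.
have [||||w Aw def_y] := IHn (n %/ p)%N _ y => //.
- by rewrite ltn_Pdiv // prime_gt1.
- by move: xn; rewrite en -def_x -mulf_div divff // mul1r.
- by exists w => //; rewrite en -mulrA def_y.
Qed.

(** If b c = n is a positive integer then a / b = a c / n, which reduces the claim to integer
    denominators. *)
Lemma adj_integral a b : A a -> A b -> b != 0 -> a / b \in Aint -> A (a / b).
Proof.
move=> Aa Ab b0 ab; have [n n_gt0 [c Ac def_n]] := adj_dvd_nat m_gt1 z_prim Ab b0.
have n0 : n%:R != 0 :> algC by rewrite pnatr_eq0 -lt0n.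
have c0 : c != 0 by apply: contraNneq n0 => c0; rewrite -def_n c0 mulr0.
have e : a / b = a * c / n%:R by rewrite -def_n -mulf_div divff ?mulr1.
have [|y Ay def_y] := @adj_integral_nat n (a * c) n_gt0 (adjM Aa Ac); first by rewrite -e.
by rewrite e -def_y mulrAC divff // mul1r.
Qed.

Lemma rat_horner_frac (p : {poly rat}) : exists (a : algC) (d : int),
  [/\ A a, d != 0 & (map_poly ratr p).[z] = a / d%:~R].
Proof.
have [p' [d d0 ->]] := rat_poly_scale p.
exists (map_poly intr p').[z], d; split=> //; first by exists p'.
rewrite map_polyZ /= hornerZ fmorphV rmorph_int mulrC; congr (_.[_] / _).
by rewrite -map_poly_comp; apply: eq_map_poly => c /=; rewrite rmorph_int.
Qed.

(** Clearing rational denominators makes x a quotient of two elements of [A]. This identifies the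
    ring that enters [class_number] with [A]. *)
Lemma ring_of_integers_adj : ring_of_integers (rat_adjoin z) = A.
Proof.
apply/seteqP; split=> [x [[p [q [q0 def_x]]] xZ]|x Ax]; last first.
  split; last exact: (adj_Aint z_prim).
  have [p ->] := Ax; exists (map_poly intr p), 1; rewrite rmorph1 hornerC oner_eq0.
  split=> //; rewrite divr1 -map_poly_comp; congr (_.[_]).
  by apply: eq_map_poly => c /=; rewrite rmorph_int.
have [a [d [Aa d0 ea]]] := rat_horner_frac p.
have [b [d' [Ab d'0 eb]]] := rat_horner_frac q.
have b0 : b != 0 by apply: contraNneq q0 => b0; rewrite eb b0 mul0r.
have e : x = (a * d'%:~R) / (d%:~R * b).
  by rewrite def_x ea eb invf_div mulf_div mulrC.
rewrite e; apply: adj_integral; rewrite -?e //.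
- by apply: adjM => //; exact: adj_int.
- by apply: adjM => //; exact: adj_int.
- by rewrite mulf_neq0 // intr_eq0.
Qed.

End Integral.

(** * Integrality from a difference of two powers *)

Lemma Aint_integralOver x : x \in Aint -> integralOver (intr : int -> algC) x.
Proof.
rewrite unfold_in => /floorpP[p def_p]; exists p.
  have := minCpoly_monic x; rewrite def_p !monicE lead_coef_map_inj //.
    by rewrite -(rmorph1 (intr : int -> algC)) => /eqP/intr_inj ->.
  exact: intr_inj.
by rewrite -def_p root_minCpoly.
Qed.

Lemma integralOver_Aint x : integralOver (intr : int -> algC) x -> x \in Aint.
Proof.
move=> [p p_mon px]; apply: root_monic_Aint px _ _; first exact: monic_map.
by apply/polyOverP => i; rewrite coef_map /= intr_int.
Qed.

(** x is a root of the monic polynomial X^j - X^i - a, whose coefficients are algebraic integers,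
    and integrality is transitive. *)
Lemma subX_Aint (x : algC) i j : (i < j)%N -> x ^+ j - x ^+ i \in Aint -> x \in Aint.
Proof.
move=> lt_ij; set a := _ - _ => aZ; apply: integralOver_Aint.
pose p : {poly algC} := 'X^j - ('X^i + a%:P).
have sz : (size ('X^i + a%:P : {poly algC})%R < size ('X^j : {poly algC})%R)%N.
  rewrite size_polyXn ltnS (leq_trans (size_polyD _ _)) // geq_max size_polyXn lt_ij.
  by rewrite (leq_trans (size_polyC_leq1 _)) // (leq_ltn_trans _ lt_ij).
apply: (@integral_root_monic _ _ _ x p).
- by rewrite monicE lead_coefDl ?size_polyN // lead_coefXn.
- by rewrite rootE hornerD hornerN hornerD !hornerXn hornerC subrKC subrr.
- move=> _ /(nthP 0)[k _ <-]; rewrite !coefB coefD !coefXn coefC.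
  apply: Aint_integralOver; apply: rpredB; first exact: rpred_nat.
  apply: rpredD; first exact: rpred_nat.
  by case: ifP => // _; exact: rpred0.
Qed.

(** * Finiteness modulo integers, Noetherian induction and invertibility of primes *)

Section Noetherian.

Variables (m : nat) (z : algC).
Hypotheses (m_gt1 : (1 < m)%N) (z_prim : m.-primitive_root z).
Local Notation A := (int_adjoin z).
Local Notation d := (totient m).

(** Representatives of [A] modulo N.+1, with coordinates on the powers of z in 0..N. The finite
    index type allows counting without forming the quotient ring. *)
Definition adj_rep N (g : {ffun 'I_d -> 'I_N.+1}) : algC :=
  \sum_(i < d) (g i)%:R * z ^+ i.

Lemma adj_rep_adj N (g : {ffun 'I_d -> 'I_N.+1}) : A (adj_rep g).
Proof.
apply: adj_sum => i _.
by apply: adjM; [exact: adj_nat | exact/adjX/adj_gen].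
Qed.

Lemma adj_rep_exists N x : A x ->
  exists g : {ffun 'I_d -> 'I_N.+1}, principal_ideal A N.+1%:R (x - adj_rep g).
Proof.
move=> Ax; have [r sz_r ->] := adj_reduce z_prim Ax.
have idN := principal_is_ideal (adj_nat z N.+1).
exists [ffun i : 'I_d => inord `|(r`_i %% N.+1)%Z|%N].
rewrite (@horner_coef_wide _ d); last first.
  by rewrite size_map_inj_poly //; exact: intr_inj.
rewrite /adj_rep -sumrB; apply: (ideal_sum idN) => i _.
rewrite coef_map /= ffunE -mulrBl; apply: (idealMr idN); first exact/adjX/adj_gen.
have r_ge0 : (0 <= (r`_i %% N.+1)%Z) by rewrite modz_ge0.
rewrite inordK; last first.
  by rewrite -ltz_nat gez0_abs // ltz_mod.
rewrite {1}(divz_eq r`_i N.+1) -[in X in _ - X](gez0_abs r_ge0) rmorphD /=.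
rewrite -[X in _ - X]/((Posz `|(r`_i %% N.+1)%Z|)%:~R) gez0_abs // addrK rmorphM /=.
by apply: (idealMl idN); [exact: adj_int | exact: principal_self].
Qed.

Lemma adj_pigeonhole n (f : nat -> algC) : (0 < n)%N -> (forall i, A (f i)) ->
  exists i j, (i < j)%N /\ principal_ideal A n%:R (f j - f i).
Proof.
case: n => // N _ Af; have idN := principal_is_ideal (adj_nat z N.+1).
have [g fg] := choice (fun i => adj_rep_exists N (Af i)).
pose F := {ffun 'I_d -> 'I_N.+1}; pose h (i : 'I_(#|{: F}|.+1)) := g i.
have /injectivePn[i [j neq_ij eq_ij]] : ~~ injectiveb h.
  by apply/negP => /injectiveP/leq_card; rewrite card_ord ltnn.
have cong : principal_ideal A N.+1%:R (f j - f i).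
  apply: (ideal_mod_trans idN (fg j)); rewrite -[g j]/(h j) -eq_ij.
  exact: (ideal_subC idN).
have [lt_ij|lt_ji|/val_inj eij] := ltngtP (i : nat) (j : nat).
- by exists i, j.
- by exists j, i; split=> //; exact: (ideal_subC idN).
- by rewrite eij eqxx in neq_ij.
Qed.

(** An ideal containing n is determined by the representatives modulo n lying in it, so the number
    of those outside drops whenever the ideal grows. *)
Lemma ideal_noeth_ind n (Pr : set algC -> Prop) : (0 < n)%N ->
  (forall I, is_ideal A I -> I n%:R ->
     (forall J, is_ideal A J -> I `<=` J -> I <> J -> Pr J) -> Pr I) ->
  forall I, is_ideal A I -> I n%:R -> Pr I.
Proof.
case: n => // N _ step I idI IN; pose F := {ffun 'I_d -> 'I_N.+1}.
pose mu (I : set algC) := #|[pred g : F | ~~ `[< I (adj_rep g) >]]|.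
have [k] := ubnP (mu I); elim: k I idI IN => // k IHk I idI IN lt_mu.
apply: step => // J idJ sIJ neqIJ; apply: IHk => //; first exact: sIJ.
rewrite -ltnS (leq_trans _ lt_mu) // ltnS; apply: proper_card.
have [x Jx nIx] : exists2 x, J x & ~ I x.
  apply: contrapT => nex; apply: neqIJ; apply/seteqP; split=> // x Jx.
  by apply: contrapT => nIx; apply: nex; exists x.
have [g xg] := adj_rep_exists N (ideal_sub idJ Jx).
have Ig : principal_ideal A N.+1%:R `<=` I by exact: principal_le.
apply/properP; split.
  apply/fintype.subsetP=> h; rewrite !inE; apply: contra => /asboolP Ih.
  exact/asboolP/sIJ.
exists g; rewrite inE.
  by apply/asboolP => /(ideal_modl idI (Ig _ xg)).
rewrite negbK; apply/asboolP.
by apply: (ideal_modr idJ _ Jx); exact/sIJ/Ig.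
Qed.

(** If xy lies in I but x and y do not, then I + (x) is larger and still proper: 1 = i + x a would
    give y = i y + a x y in I. Noetherian induction ends at a prime. *)
Lemma prime_ideal_exists n I : (0 < n)%N -> is_ideal A I -> I n%:R -> ~ I 1 ->
  exists2 P, is_prime_ideal A P & I `<=` P.
Proof.
move=> n_gt0; move: I; apply: (@ideal_noeth_ind n) => // I idI In IH nI1.
have [[x [y [Ax Ay Ixy nIx nIy]]]|nex] :=
  pselect (exists x y, [/\ A x, A y, I (x * y), ~ I x & ~ I y]); last first.
  exists I => //; split=> //; first by move=> IA; apply: nI1; rewrite IA; exact: adj1.
  move=> x y Ax Ay Ixy; have [Ix|nIx] := pselect (I x); [by left | right].
  by apply: contrapT => nIy; apply: nex; exists x, y.
pose J : set algC := [set u | exists i a, [/\ I i, A a & u = i + x * a]].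
have sIJ : I `<=` J.
  by move=> i Ii; exists i, 0; rewrite mulr0 addr0; split=> //; exact: adj0.
have Jx : J x.
  by exists 0, 1; rewrite mulr1 add0r; split=> //; [exact: ideal0 idI|exact: adj1].
have idJ : is_ideal A J.
  split.
  - move=> _ [i [a [Ii Aa ->]]]; apply: adjD; last exact: adjM.
    exact: (ideal_sub idI).
  - exact/sIJ/(ideal0 idI).
  - move=> _ _ [i [a [Ii Aa ->]]] [j [b [Ij Ab ->]]]; exists (i + j), (a + b).
    by split; [exact: (idealD idI)|exact: adjD|rewrite mulrDr addrACA].
  - move=> c _ Ac [i [a [Ii Aa ->]]]; exists (c * i), (c * a).
    by split; [exact: (idealMl idI)|exact: adjM|rewrite mulrDr mulrCA].
have [||P prP sJP] := IH J idJ sIJ.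
- by move=> eIJ; apply: nIx; rewrite eIJ.
- move=> [i [a [Ii Aa def1]]]; apply: nIy.
  rewrite -[y]mul1r def1 mulrDl mulrAC; apply: (idealD idI); exact: (idealMr idI).
- by exists P => // u /sIJ/sJP.
Qed.

Lemma prime_ideal_periodic P p : is_prime_ideal A P -> prime p -> P p%:R ->
  exists a, [/\ frob_periodic z a, P a & principal_ideal A a p%:R].
Proof.
move=> prP p_pr Pp; have [s ss def_p] := frob_product_prime m_gt1 z_prim p_pr.
have As : {in s, forall a, A a} by move=> a /ss[].
move: Pp; rewrite def_p => /(prime_ideal_prod prP As)[a sa Pa].
exists a; split=> //; first exact: ss.
exact: (dvd_prod (F := id)).
Qed.

(** Take a periodic factor a of p lying in P, and for K the ideal quotient (a : P). An element b of
    K with 1 - b in P gives a = (1 - b) a + a b in P K. *)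
Lemma prime_ideal_invertible P p : is_prime_ideal A P -> prime p -> P p%:R ->
  exists a K, [/\ principal_ideal A a p%:R, A a, is_ideal A K
    & ideal_mul P K = principal_ideal A a].
Proof.
move=> prP p_pr Pp; have [idP _ _] := prP.
have [a [[Aa a0 [N N_gt1 aN]] Pa ap]] := prime_ideal_periodic prP p_pr Pp.
have ida := principal_is_ideal Aa.
pose K : set algC := [set x | A x /\ forall y, P y -> principal_ideal A a (x * y)].
have idK : is_ideal A K.
  split.
  - by move=> x [].
  - by split=> [|y _]; [exact: adj0|rewrite mul0r; exact: ideal0 ida].
  - move=> x y [Ax Kx] [Ay Ky]; split=> [|u Pu]; first exact: adjD.
    by rewrite mulrDl; apply: (idealD ida); [exact: Kx|exact: Ky].
  - move=> b x Ab [Ax Kx]; split=> [|u Pu]; first exact: adjM.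
    by rewrite -mulrA; apply: (idealMl ida) => //; exact: Kx.
exists a, K; split=> //.
have idPK := is_ideal_mul idP idK.
apply/seteqP; split.
  apply: ideal_mul_ind; [exact: (ideal0 ida)|by move=> *; exact: (idealD ida)|].
  by move=> x y Px [_ Ky]; rewrite mulrC; exact: Ky.
apply: principal_le => //.
have [p' def_p'] : exists p', p = p'.+1 by case: (p) p_pr => // k; exists k.
pose F := {ffun 'I_d -> 'I_p'.+1}.
(* [1 - b] is an idempotent modulo [a] that generates [P] modulo [a]. *)
pose b := \prod_(g : F | `[< P (adj_rep g) >]) (1 - adj_rep g ^+ N.-1).
have Arep (g : F) : A (1 - adj_rep g ^+ N.-1).
  by apply: adjB; [exact: adj1|exact/adjX/adj_rep_adj].
have Ab : A b by apply: adj_prod => g _; exact: Arep.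
have Pb : P (1 - b).
  apply: (big_ind (fun c => P (1 - c))).
  - by rewrite subrr; exact: (ideal0 idP).
  - move=> x y Px Py; rewrite -(subrK x 1) -addrA -{2}[x]mulr1 -mulrBr.
    apply: (idealD idP) => //; apply: (idealMl idP) => //.
    rewrite -[x]opprK -[- x](addKr 1) opprD opprK.
    by apply: adjB; [exact: adj1|exact: (ideal_sub idP)].
  - move=> g /asboolP Pg; rewrite subKr; apply: (idealX idP) => //.
    by rewrite -ltnS prednK // ltnW.
(* An element of P is congruent modulo a to some representative g in P, and the factor 1 - g^(N-1)
   of b kills g, since g^N and g agree modulo a. *)
have Kb : K b.
  split=> // y Py; have [g yg] := adj_rep_exists p' (ideal_sub idP Py).
  have ayg : principal_ideal A a (y - adj_rep g).
    by move: yg; rewrite -def_p'; exact: principal_le.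
  have Pg : P (adj_rep g).
    by apply: (ideal_modr idP _ Py); exact: (principal_le idP Pa).
  apply: (@ideal_modl _ _ ida _ (b * adj_rep g)).
    by rewrite -mulrBr; exact: (idealMl ida).
  rewrite /b (bigD1 g) /=; last exact/asboolP.
  rewrite mulrAC.
  apply: (idealMr ida); first by apply: adj_prod => h _; exact: Arep.
  rewrite mulrBl mul1r -exprSr prednK; last exact: ltnW.
  by apply: (ideal_subC ida); apply: aN; exact: adj_rep_adj.
have Ka : K a.
  by split=> // y Py; exists y => //; exact: (ideal_sub idP).
rewrite -[a](subrK ((1 - b) * a)) addrC; apply: (idealD idPK).
  exact: ideal_mul_in.
by rewrite mulrBl mul1r opprB addrC subrK mulrC; exact: ideal_mul_in.
Qed.

(** P contains some prime factor p of t = c p. If P K = (a) and p = a s, the cofactor is s c K. *)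
Lemma prime_ideal_divides P t : (0 < t)%N -> is_prime_ideal A P -> P t%:R ->
  ideal_divides A P (principal_ideal A t%:R).
Proof.
move=> t_gt0 prP Pt; have [idP _ PM] := prP.
have [p p_pr [/dvdnP[c def_t] Pp]] : exists2 p, prime p & (p %| t)%N /\ P p%:R.
  elim/ltn_ind: t t_gt0 Pt => t IHt t_gt0 Pt.
  have [t_le1|t_gt1] := leqP t 1.
    case: (prime_ideal_proper prP); move: Pt.
    by rewrite (@anti_leq t 1) ?t_le1.
  have p_pr := pdiv_prime t_gt1; have /dvdnP[c def_t] := pdiv_dvd t.
  move: Pt; rewrite {1}def_t natrM => /PM[||Pc|Pp]; try exact: adj_nat.
    have c_gt0 : (0 < c)%N by move: t_gt0; rewrite def_t; case: (c).
    have [|p' p'_pr [p'c Pp']] := IHt c _ c_gt0 Pc.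
      by rewrite [X in (_ < X)%N]def_t ltn_Pmulr // prime_gt1.
    by exists p' => //; split=> //; rewrite def_t dvdn_mulr.
  by exists (pdiv t) => //; rewrite pdiv_dvd.
have [a [K [[s As def_p] Aa idK PK]]] := prime_ideal_invertible prP p_pr Pp.
exists (scale_set (s * c%:R) K).
  apply: scale_ideal => // x Kx; apply: adjM; last exact: (ideal_sub idK).
  by apply: adjM => //; exact: adj_nat.
rewrite -scale_mulr PK /principal_ideal scale_scale; congr (scale_set _ _).
by rewrite def_t natrM -def_p mulrC [RHS]mulrC mulrA.
Qed.

(* [x ^+ i * n] stays in [I] for some fixed integer [n], so two powers of [x] are
   congruent modulo [A] and [x] is integral. *)
Lemma ideal_stabilizer I x : is_nonzero_ideal A I ->
  (forall y, I y -> I (x * y)) -> A x.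
Proof.
move=> [idI [y Iy y0]] xI; have Ay := ideal_sub idI Iy.
have [n n_gt0 [c Ac def_n]] := adj_dvd_nat m_gt1 z_prim Ay y0.
have n0 : n%:R != 0 :> algC by rewrite pnatr_eq0 -lt0n.
have In : I n%:R by rewrite -def_n; exact: (idealMr idI).
have Ixn i : I (x ^+ i * n%:R).
  by elim: i => [|i IHi]; rewrite ?expr0 ?mul1r // exprS -mulrA; exact: xI.
have [i [j [lt_ij [u Au]]]] := adj_pigeonhole n_gt0 (fun i => ideal_sub idI (Ixn i)).
rewrite -mulrBl mulrC => /(mulIf n0) def_u.
have xZ : x \in Aint.
  by apply: subX_Aint lt_ij _; rewrite -def_u; exact: (adj_Aint z_prim).
have -> : x = x * n%:R / n%:R by rewrite mulfK.
apply: (adj_integral m_gt1 z_prim) => //; rewrite ?mulfK //; last exact: adj_nat.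
exact/(ideal_sub idI)/xI.
Qed.

End Noetherian.

(** * Free cyclic actions and the action of an ideal on ideal classes *)

Lemma free_iter_id (F : finType) (T : F -> F) n : (0 < n)%N ->
  (forall x, iter n T x = x) ->
  (forall k x, iter k T x = x -> forall y, iter k T y = y) ->
  coprime n #|F| -> forall x, T x = x.
Proof.
move=> n_gt0 Tn free_T co_nF.
have T_inj : injective T.
  by move=> x y eT; rewrite -(Tn x) -(Tn y) -(prednK n_gt0) !iterSr eT.
(* A power of [s] fixing one point is the identity, so the group generated by [s] acts freely and
   all its orbits have [#[s]] elements. This order divides both n and the size of [F]. *)
pose s := perm T_inj.
have sX k x : (s ^+ k)%g x = iter k T x.
  by rewrite permX; apply: eq_iter => y; rewrite permE.
have s_dvd_n : (#[s]%g %| n)%N.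
  by rewrite order_dvdn; apply/eqP/permP=> x; rewrite sX Tn perm1.
have s_dvd_F : (#[s]%g %| #|F|)%N.
  have actsG : [acts <[s]>%g, on finset.setTfor F | 'P].
    by apply/fintype.subsetP=> g _; rewrite !inE; apply/fintype.subsetP=> x; rewrite !inE.
  rewrite -cardsT (@card_uniform_partition _ #[s]%g _ _ _ (orbit_partition actsG)).
    exact: dvdn_mull.
  move=> _ /imsetP[x _ ->].
  rewrite /order -(card_orbit_stab 'P <[s]>%G x).
  suff -> : ('C_(<[s]>)[x | 'P] = 1)%g by rewrite cards1 muln1.
  apply/trivgP/fintype.subsetP=> g /setIP[/cycleP[k ->]].
  move=> /astab1P /=; rewrite apermE sX => /free_T fix_k.
  by rewrite inE; apply/eqP/permP=> y; rewrite sX fix_k perm1.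
have s1 : s = 1%g.
  apply/eqP; rewrite -order_eq1 -dvdn1.
  by move: co_nF; rewrite /coprime => /eqP <-; rewrite dvdn_gcd s_dvd_n.
by move=> x; rewrite -[T x]/(iter 1 T x) -sX s1 expg1 perm1.
Qed.

Definition ideal_pow (R Q : set algC) k := iter k (ideal_mul Q) R.

(** Multiplication of a class by Q, ranging over all ideals I of the class so that no representative
    has to be chosen. *)
Definition class_mul (R Q : set algC) (c : set (set algC)) : set (set algC) :=
  [set J | is_nonzero_ideal R J /\
     exists2 I, c I & ideal_equiv R (ideal_mul Q I) J].

Section ClassGroup.

Variables (m : nat) (z : algC).
Hypotheses (m_gt1 : (1 < m)%N) (z_prim : m.-primitive_root z).
Local Notation A := (int_adjoin z).

Lemma nonzero_ideal_full : is_nonzero_ideal A A.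
Proof.
split; first exact: is_ideal_full.
by exists 1; [exact: adj1|rewrite oner_eq0].
Qed.

Lemma nonzero_ideal_mul I J : is_nonzero_ideal A I -> is_nonzero_ideal A J ->
  is_nonzero_ideal A (ideal_mul I J).
Proof.
move=> [idI [x Ix x0]] [idJ [y Jy y0]]; split; first exact: is_ideal_mul.
by exists (x * y); [exact: ideal_mul_in | rewrite mulf_neq0].
Qed.

Section Power.

Variable Q : set algC.

Lemma is_ideal_pow k : is_ideal A Q -> is_ideal A (ideal_pow A Q k).
Proof.
move=> idQ; elim: k => [|k IHk]; first exact: is_ideal_full.
exact: is_ideal_mul.
Qed.

Lemma ideal_powX y k : Q y -> ideal_pow A Q k (y ^+ k).
Proof.
move=> Qy; elim: k => [|k IHk]; first by rewrite expr0; exact: adj1.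
by rewrite exprS; exact: ideal_mul_in.
Qed.

Lemma ideal_pow_mul R q k : is_ideal A Q -> is_ideal A R -> A q ->
  ideal_mul Q R = principal_ideal A q ->
  ideal_mul (ideal_pow A Q k) (ideal_pow A R k) = principal_ideal A (q ^+ k).
Proof.
move=> idQ idR Aq QR; elim: k => [|k IHk].
  by rewrite expr0 /principal_ideal scale1 ideal_mul1 //; exact: is_ideal_full.
rewrite /ideal_pow !iterS -!/(ideal_pow A _ k).
rewrite -ideal_mulA [ideal_mul (ideal_pow A Q k) _]ideal_mulC -ideal_mulA.
rewrite [ideal_mul (ideal_pow A R k) _]ideal_mulC IHk ideal_mulA QR principal_mul.
  by rewrite /principal_ideal scale_scale exprS.
exact/principal_is_ideal/adjX.
Qed.

Lemma iter_ideal_mul k I : is_ideal A I ->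
  iter k (ideal_mul Q) I = ideal_mul (ideal_pow A Q k) I.
Proof.
move=> idI; elim: k => [|k IHk]; first by rewrite ideal_mul1.
by rewrite iterS IHk ideal_mulA.
Qed.

End Power.

Lemma ideal_equiv_refl I : ideal_equiv A I I.
Proof. by exists 1, 1; rewrite oner_eq0; split=> //; exact: adj1. Qed.

Lemma ideal_equiv_sym I J : ideal_equiv A I J -> ideal_equiv A J I.
Proof. by move=> [a [b [Aa Ab a0 b0 e]]]; exists b, a. Qed.

Lemma ideal_equiv_trans J I K :
  ideal_equiv A I J -> ideal_equiv A J K -> ideal_equiv A I K.
Proof.
move=> [a [b [Aa Ab a0 b0 e]]] [c [d [Ac Ad c0 d0 e']]].
exists (c * a), (b * d); rewrite !mulf_neq0 //.
split=> //; do ?exact: adjM.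
by rewrite -!scale_scale e -e' !scale_scale mulrC.
Qed.

Lemma ideal_equiv_mul Q I J : ideal_equiv A I J ->
  ideal_equiv A (ideal_mul Q I) (ideal_mul Q J).
Proof.
by move=> [a [b [Aa Ab a0 b0 e]]]; exists a, b; split=> //; rewrite !scale_mulr e.
Qed.

Lemma ideal_equiv_principal_mul I x : is_ideal A I -> A x -> x != 0 ->
  ideal_equiv A (ideal_mul (principal_ideal A x) I) I.
Proof.
move=> idI Ax x0; exists 1, x; rewrite oner_eq0 principal_mul // scale1.
by split=> //; exact: adj1.
Qed.

Lemma eq_ideal_class I J : is_nonzero_ideal A J ->
  ideal_class A I = ideal_class A J -> ideal_equiv A I J.
Proof.
move=> nzJ e; have : ideal_class A J J by split=> //; exact: ideal_equiv_refl.
by rewrite -e => -[].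
Qed.

Lemma ideal_class_eq I J : ideal_equiv A I J -> ideal_class A I = ideal_class A J.
Proof.
move=> IJ; apply/seteqP; split=> K [nzK eqK]; split=> //.
  exact: ideal_equiv_trans (ideal_equiv_sym IJ) eqK.
exact: ideal_equiv_trans IJ eqK.
Qed.

Lemma class_mul_class Q I : is_nonzero_ideal A I ->
  class_mul A Q (ideal_class A I) = ideal_class A (ideal_mul Q I).
Proof.
move=> nzI; apply/seteqP; split=> J [nzJ].
  move=> [K [_ IK] KJ]; split=> //.
  by apply: ideal_equiv_trans KJ; exact: ideal_equiv_mul.
move=> QIJ; split=> //; exists I => //.
by split=> //; exact: ideal_equiv_refl.
Qed.

Lemma iter_class_mul Q I k : is_nonzero_ideal A Q -> is_nonzero_ideal A I ->
  iter k (class_mul A Q) (ideal_class A I) =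
  ideal_class A (ideal_mul (ideal_pow A Q k) I).
Proof.
move=> nzQ nzI; rewrite -iter_ideal_mul; last by case: nzI.
have nz j : is_nonzero_ideal A (iter j (ideal_mul Q) I).
  by elim: j => // j IHj; exact: nonzero_ideal_mul.
by elim: k => // k IHk; rewrite iterS IHk class_mul_class.
Qed.

(** Equivalence gives J I = x I with x = b / a. Then x^-1 J stabilizes I, and so does (c / x)^-1 B
    because B J I = c I; both therefore lie in [A], and J B = (c) forces J = (x). *)
Lemma invertible_equiv_principal J B c I :
  is_ideal A J -> is_ideal A B -> c != 0 ->
  ideal_mul J B = principal_ideal A c -> is_nonzero_ideal A I ->
  ideal_equiv A (ideal_mul J I) I -> is_principal A J.
Proof.
move=> idJ idB c0 JB nzI [a [b [Aa Ab a0 b0 e]]]; have [idI _] := nzI.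
pose x := b / a; have x0 : x != 0 by rewrite mulf_neq0 ?invr_eq0.
have JI : ideal_mul J I = scale_set x I.
  apply: (scaleI a0); rewrite e scale_scale; congr (scale_set _ _).
  by rewrite mulrCA divff ?mulr1.
move: x x0 JI => {e} x x0 JI.
have defJ : J = principal_ideal A x.
  apply: (@factor_principal _ J B x (c / x)) => //.
  - by rewrite mulf_neq0 ?invr_eq0.
  - move=> j Jj; apply: (ideal_stabilizer m_gt1 z_prim nzI) => y Iy.
    have : ideal_mul J I (j * y) by exact: ideal_mul_in.
    by rewrite JI => -[w Iw e']; rewrite -mulrA -e' mulKf.
  - move=> u Bu; apply: (ideal_stabilizer m_gt1 z_prim nzI) => y Iy.
    have : ideal_mul B (ideal_mul J I) (u * (x * y)).
      by apply: ideal_mul_in => //; rewrite JI; exists y.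
    rewrite ideal_mulA [ideal_mul B J]ideal_mulC JB principal_mul // => -[w Iw e'].
    have -> : (c / x)^-1 * u * y = c^-1 * (u * (x * y)).
      by rewrite invf_div -!mulrA mulrCA [in RHS](mulrCA u).
    by rewrite -e' mulKf.
  - by rewrite JB mulrCA divff ?mulr1.
by exists x => //; apply: (ideal_sub idJ); rewrite defJ; exact: principal_self.
Qed.

Lemma principal_of_coprime_power Q R q n a :
  is_nonzero_ideal A Q -> is_ideal A R -> A q -> q != 0 ->
  ideal_mul Q R = principal_ideal A q ->
  (0 < n)%N -> A a -> a != 0 -> ideal_pow A Q n = principal_ideal A a ->
  (0 < class_number (rat_adjoin z))%N ->
  coprime n (class_number (rat_adjoin z)) -> is_principal A Q.
Proof.
move=> nzQ idR Aq q0 QR n_gt0 Aa a0 Qn.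
rewrite /class_number (ring_of_integers_adj m_gt1 z_prim).
set C := ideal_classes A => h_gt0 co_nh; have [idQ _] := nzQ.
(* [fset_set] of an infinite set is empty, so a positive class number forces finitely many
   classes. *)
have finC : finite_set C.
  apply: contrapT => infC; move: h_gt0; rewrite /fset_set.
  by case: pselect => // _; rewrite cardfs0.
pose F : finType := fset_set C.
have inC (x : F) : exists2 I, is_nonzero_ideal A I & ideal_class A I = val x.
  by have := valP x; rewrite in_fset_set // inE.
have CF c : C c -> c \in fset_set C by rewrite in_fset_set // inE.
have mulC (x : F) : class_mul A Q (val x) \in fset_set C.
  apply: CF; have [I nzI <-] := inC x; rewrite class_mul_class //.
  by exists (ideal_mul Q I) => //; exact: nonzero_ideal_mul.
pose T (x : F) : F := FSetSub (mulC x).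
have val_iter k x : val (iter k T x) = iter k (class_mul A Q) (val x).
  by elim: k => // k IHk; rewrite !iterS -IHk.
have principal_fix k : is_principal A (ideal_pow A Q k) -> forall x, iter k T x = x.
  move=> [b Ab def_b] x; apply/val_inj; rewrite val_iter.
  have [I nzI <-] := inC x; rewrite iter_class_mul // def_b.
  apply/ideal_class_eq/ideal_equiv_principal_mul => //; first by case: nzI.
  (* The generator is nonzero because Q^k contains y^k for a nonzero y in Q. *)
  apply/negP=> /eqP b0; have [y Qy y0] := nzQ.2.
  have := ideal_powX k Qy; rewrite def_b b0 => -[w _].
  by rewrite mul0r => /esym/eqP; rewrite expf_eq0 (negPf y0) andbF.
have fix_principal k x : iter k T x = x -> is_principal A (ideal_pow A Q k).
  have [I nzI defx] := inC x.
  move=> /(congr1 val); rewrite val_iter -defx iter_class_mul // => e.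
  apply: (invertible_equiv_principal _ _ _ (ideal_pow_mul k idQ idR Aq QR) nzI).
  - exact: is_ideal_pow.
  - exact: is_ideal_pow.
  - by rewrite expf_neq0.
  - exact: eq_ideal_class.
(* A power of Q fixing one class is principal and so fixes all of them: the freeness required by
   [free_iter_id]. *)
have T_id : forall x, T x = x.
  apply: (free_iter_id n_gt0); last by rewrite -cardfE.
    by apply: principal_fix; exists a.
  by move=> k x /fix_principal/principal_fix.
have CA : ideal_class A A \in fset_set C.
  by apply: CF; exists A => //; exact: nonzero_ideal_full.
(* The first power, acting on the trivial class, yields that Q itself is principal. *)
have := @fix_principal 1%N (FSetSub CA) (T_id _).
by rewrite /ideal_pow /= ideal_mulC ideal_mul1.
Qed.

End ClassGroup.

(** * Primes above q, their conjugates, and complex conjugation *)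

Section SplitPrime.

Variables (m : nat) (z : algC).
Hypotheses (m_gt1 : (1 < m)%N) (z_prim : m.-primitive_root z).
Local Notation A := (int_adjoin z).
Local Notation U := {unit 'Z_m}.
Local Notation gal := (gal m_gt1).

Lemma natr_Zm_eq i j : (i%:R == j%:R :> 'Z_m) = (i == j %[mod m]).
Proof.
by apply/eqP/eqP=> [/(congr1 val)|e]; [|apply/val_inj]; rewrite /= !val_Zp_nat.
Qed.

(** For m > 2 the unit -1 has order 2, which divides the order of the unit group. *)
Lemma totient_half : (2 < m)%N -> (totient m = (totient m %/ 2).*2)%N.
Proof.
move=> m_gt2; rewrite -muln2 divnK //.
have UN1 : (-1 : 'Z_m) \is a GRing.unit := unitrN1 _.
pose u : U := FinRing.unit 'Z_m UN1.
have u2 : (u ^+ 2 = 1)%g.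
  by apply/val_inj; rewrite FinRing.val_unitX /= expr2 mulrN1 opprK.
have u1 : (u != 1)%g.
  apply: contraTneq m_gt2 => /(congr1 val) /= /eqP.
  rewrite eq_sym -addr_eq0 -[1 + 1]/(2%:R) -[0]/(0%:R) natr_Zm_eq.
  by rewrite mod0n -leqNgt => /dvdn_leq; apply.
rewrite -card_unit_Zm // -cardsT.
have <- : #[u]%g = 2%N by apply: nt_prime_order.
by apply: order_dvdG; rewrite inE.
Qed.

(** The powers of the class of q form a subgroup of index 2; any a outside it represents the other
    coset. *)
Lemma mult_order_index2 q (x : U) : (2 < m)%N ->
  val x = q%:R -> is_mult_order m q (totient m %/ 2)%N ->
  exists a : U, forall u : U, exists i, u = (x ^+ i)%g \/ u = (x ^+ i * a)%g.
Proof.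
move=> m_gt2 def_x [f_gt0 qf minf]; set f := (totient m %/ 2)%N in f_gt0 qf minf.
have xk1 k : (x ^+ k == 1)%g = (q ^ k == 1 %[mod m]).
  rewrite -natr_Zm_eq natrX -def_x -FinRing.val_unitX.
  by apply/eqP/eqP=> [->|e] //; apply/val_inj.
have ord_x : #[x]%g = f.
  apply/eqP; rewrite eqn_leq minf ?order_gt0 //; last first.
    by apply/eqP; rewrite -xk1 expg_order.
  by rewrite dvdn_leq // order_dvdn xk1 qf.
have cardU : #|finset.setTfor U| = (f + f)%N.
  by rewrite cardsT card_unit_Zm // totient_half // addnn.
have [a nHa] : exists a, a \notin <[x]>%g.
  apply/existsP; rewrite -negb_forall; apply/negP => /forallP allH.
  have : (#|finset.setTfor U| <= #|<[x]>%g|)%N.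
    by apply/subset_leq_card/fintype.subsetP=> u _; exact: allH.
  by rewrite cardU -/(order x) ord_x leqNgt -{1}[f]addn0 ltn_add2l f_gt0.
exists a => u.
have : u \in (<[x]> :|: <[x]> :* a)%g.
  suff -> : (<[x]> :|: <[x]> :* a)%g = finset.setTfor U by rewrite inE.
  have disj : (<[x]> :&: <[x]> :* a)%g = finset.set0.
    apply/eqP; rewrite -finset.subset0; apply/fintype.subsetP=> v.
    rewrite inE mem_rcoset => /andP[Hv Hva].
    by case/negP: nHa; rewrite -groupV -(groupMl _ Hv).
  apply/eqP; rewrite eqEcard finset.subsetT cardU cardsU card_rcoset disj.
  by rewrite cards0 subn0 -/(order x) ord_x leqnn.
rewrite inE mem_rcoset => /orP[/cycleP[i ->]|/cycleP[i /(canRL (mulgKV a)) ->]].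
  by exists i; left.
by exists i; right.
Qed.

(** The quotient n / q is rational and an algebraic integer, hence an integer. *)
Lemma principal_nat q n : (0 < q)%N -> principal_ideal A q%:R n%:R -> (q %| n)%N.
Proof.
move=> q_gt0 [y Ay e]; have q0 : q%:R != 0 :> algC by rewrite pnatr_eq0 -lt0n.
have def_y : y = n%:R / q%:R by rewrite -e mulrC mulKf.
have /intrP[k def_k] : y \in Num.int.
  apply: Cint_rat_Aint; last exact: (adj_Aint z_prim).
  by rewrite def_y; apply: rpred_div; exact: rpred_nat.
have : (q%:Z * k)%:~R = n%:Z%:~R :> algC by rewrite rmorphM /= -def_k.
move=> /intr_inj/(congr1 absz); rewrite abszM /= => <-.
exact: dvdn_mulr.
Qed.

Section PrimeOver.

Variables (q : nat) (Q : set algC).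
Hypotheses (q_prime : prime q) (co_qm : coprime q m).
Hypotheses (prQ : is_prime_ideal A Q) (Qq : Q q%:R).
Let idQ : is_ideal A Q. Proof. by case: prQ. Qed.
Let Aq : A q%:R := adj_nat z q.
Let idq := principal_is_ideal Aq.
Let sqQ : principal_ideal A q%:R `<=` Q.
Proof. exact: principal_le. Qed.

(** For some N > 1 the product x (1 - x^(N-1)) vanishes modulo q, hence lies in Q. As x does not,
    the second factor does, and x^(N-2) inverts x modulo Q. *)
Lemma prime_over_maximal x : A x -> ~ Q x -> exists2 w, A w & Q (1 - x * w).
Proof.
move=> Ax nQx; have [_ _ [N N_gt1 qN]] :=
  frob_periodic_coprime m_gt1 z_prim q_prime co_qm.
have [_ _ QM] := prQ.
exists (x ^+ N.-2); first exact: adjX.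
have : Q (x * (1 - x * x ^+ N.-2)).
  rewrite mulrBr mulr1 -!exprS prednK ?prednK //; last by rewrite -ltnS prednK // ltnW.
    exact/(ideal_subC idQ)/sqQ/qN.
  exact: ltnW.
move=> /QM[] //; apply: adjB; [exact: adj1|].
by apply: adjM => //; exact: adjX.
Qed.

Lemma prime_over_int n : Q n%:~R -> (q %| n)%Z.
Proof.
move=> Qn; apply: contrapT => /negP ndvd.
have /coprimezP[[u v] /= uv] : coprimez q n.
  by rewrite coprimezE prime_coprime // -dvdzE.
apply: (prime_ideal_proper prQ).
have -> : 1 = u%:~R * q%:R + v%:~R * n%:~R :> algC.
  by rewrite -[q%:R]/(q%:Z%:~R) -!intrM -intrD uv.
by apply: (idealD idQ); apply: (idealMl idQ) => //; exact: adj_int.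
Qed.

(* [1 - x ^+ N.-1] annihilates [x] modulo [q], while its norm is an integer
   congruent to 1 modulo [Q], hence modulo [q]. *)
Lemma prime_over_conjugates x : A x -> (forall u : U, Q (gal u x)) ->
  principal_ideal A q%:R x.
Proof.
move=> Ax Qx; have [_ _ [N N_gt1 qN]] :=
  frob_periodic_coprime m_gt1 z_prim q_prime co_qm.
pose w := 1 - x ^+ N.-1.
have N1_gt0 : (0 < N.-1)%N by rewrite -ltnS prednK // ltnW.
have Aw : A w by apply: adjB; [exact: adj1|exact: adjX].
have [n def_n] := adj_norm_int m_gt1 z_prim Aw.
have [r Ar def_r] := adj_norm_dvd m_gt1 z_prim Aw.
have : Q (1 - n%:~R).
  suff [] : A n%:~R /\ Q (1 - n%:~R) by [].
  rewrite -def_n /adj_norm; apply: (big_ind (fun c => A c /\ Q (1 - c))).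
  - by rewrite subrr; split; [exact: adj1|exact: (ideal0 idQ)].
  - move=> c d [Ac Qc] [Ad Qd]; split; first exact: adjM.
    rewrite -[1]mulr1; apply: (ideal_modM idQ) => //; exact: adj1.
  - move=> u _; split; first exact: (gal_adj m_gt1 z_prim).
    by rewrite rmorphB rmorph1 rmorphXn subKr; exact: (idealX idQ).
rewrite -(rmorph1 (intr : int -> algC)) -rmorphB => /prime_over_int/dvdzP[c def_c].
have qn : principal_ideal A q%:R (1 - n%:~R).
  exists c%:~R; first exact: adj_int.
  by rewrite -[q%:R]/(q%:Z%:~R) -rmorphM mulrC -def_c rmorphB rmorph1.
have -> : x = x * (1 - n%:~R) + x * n%:~R by rewrite -mulrDr subrK mulr1.
apply: (idealD idq); first exact: (idealMl idq).
rewrite -def_n -def_r mulrA; apply: (idealMr idq) => //.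
rewrite mulrBr mulr1 -exprS prednK; last exact: ltnW.
exact/(ideal_subC idq)/qN.
Qed.

(** This automorphism is x -> x^q modulo q, so [gal s x] lies in Q exactly when x^q does, that is,
    when x does. *)
Lemma gal_frob (s : U) x : gal s z = z ^+ q -> A x -> Q (gal s x) <-> Q x.
Proof.
move=> gs Ax.
have qz : principal_ideal A q%:R (gal s z - z ^+ (q ^ 1)).
  by rewrite gs subrr; exact: (ideal0 idq).
have := frob_mod q_prime Aq (principal_self z _) qz Ax; rewrite expn1 => /sqQ Qsx.
split=> [Qs|Qx]; first exact/(prime_idealX prQ Ax)/(ideal_modr idQ Qsx).
by apply: (ideal_modl idQ Qsx); apply: (idealX idQ) => //; exact: prime_gt0.
Qed.

Lemma gal_frobX (s u : U) i x : gal s z = z ^+ q -> A x ->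
  Q (gal (s ^+ i * u)%g x) <-> Q (gal u x).
Proof.
move=> gs Ax; elim: i => [|i IHi]; first by rewrite expg0 mul1g.
rewrite expgS -mulgA -(galM m_gt1 z_prim) // -IHi.
exact/gal_frob/(gal_adj m_gt1 z_prim).
Qed.

End PrimeOver.

(** A preimage rather than an image: the conjugate of Q under the inverse of [gal u]. *)
Definition conj_ideal (Q : set algC) (u : U) : set algC :=
  [set x | A x /\ Q (gal u x)].

Lemma conj_ideal_prime Q u : is_prime_ideal A Q -> is_prime_ideal A (conj_ideal Q u).
Proof.
move=> prQ; have [idQ _ QM] := prQ.
have gA x : A x -> A (gal u x) by exact: (gal_adj m_gt1 z_prim).
split; first split.
- by move=> x [].
- by split; [exact: adj0|rewrite rmorph0; exact: (ideal0 idQ)].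
- move=> x y [Ax Qx] [Ay Qy]; split; first exact: adjD.
  by rewrite rmorphD; exact: (idealD idQ).
- move=> a x Aa [Ax Qx]; split; first exact: adjM.
  by rewrite rmorphM; apply: (idealMl idQ) => //; exact: gA.
- move=> e; have : conj_ideal Q u 1 by rewrite e; exact: adj1.
  by move=> [_]; rewrite rmorph1 => /(prime_ideal_proper prQ).
- move=> x y Ax Ay [_]; rewrite rmorphM => /QM[]; try exact: gA.
    by left.
  by right.
Qed.

(** Since z has absolute value 1, its conjugate is z^-1 = z^(m-1), and m - 1 is prime to m. *)
Lemma conj_gen : exists c : U, forall x, A x -> x^* = gal c x.
Proof.
have m_gt0 := ltnW m_gt1.
have [c [_ gc]] : exists c : U, (val c : 'Z_m) = m.-1%:R /\ gal c z = z ^+ m.-1.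
  by apply: gal_exists => //; rewrite -{2}(prednK m_gt0) coprimenS.
exists c => x Ax; apply: (eq_aut_adj (f := Num.conj)) Ax; rewrite gc /=.
have z0 : z != 0 by rewrite (prim_root_eq0 z_prim) -lt0n.
have norm_z : `|z| = 1.
  apply/eqP; rewrite -(pexpr_eq1 m_gt0) // -normrX (prim_expr_order z_prim).
  by rewrite normr1.
apply: (mulfI z0); rewrite -exprS prednK // (prim_expr_order z_prim).
by rewrite -normCK norm_z expr1n.
Qed.

End SplitPrime.

(** * Reduction of the norm equation *)

Section NormEquation.

Variables (m : nat) (z : algC).
Hypotheses (m_gt1 : (1 < m)%N) (z_prim : m.-primitive_root z).
Local Notation A := (int_adjoin z).

Lemma conj_adj x : A x -> A x^*.
Proof.
move=> Ax; have [c ->] := conj_gen m_gt1 z_prim => //.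
exact: (gal_adj m_gt1 z_prim).
Qed.

(** If x = q y, dividing the equation by q^2 lowers e by one. At e = 0 the same division would make
    q divide t. *)
Lemma norm_equation_descent t q e x : prime q -> ~~ (q %| t)%N -> A x ->
  x * x^* = t%:R * q%:R ^+ (2 * e + 1) ->
  exists e' y, [/\ (e' <= e)%N, A y, ~ principal_ideal A q%:R y
    & y * y^* = t%:R * q%:R ^+ (2 * e' + 1)].
Proof.
move=> q_pr qt; have q_gt0 := prime_gt0 q_pr.
have q0 : q%:R != 0 :> algC by rewrite pnatr_eq0 -lt0n.
elim: e x => [|e IHe] x Ax norm_x.
  have [[y Ay def_x]|nqx] := pselect (principal_ideal A q%:R x); last first.
    by exists 0%N, x.
  case/negP: qt; apply: (principal_nat z_prim q_gt0); exists (y * y^*).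
    by apply: adjM => //; exact: conj_adj.
  apply: (mulIf q0); rewrite expr1 in norm_x; rewrite -norm_x -def_x rmorphM rmorph_nat.
  by rewrite mulrC mulrACA -!mulrA.
have [[y Ay def_x]|nqx] := pselect (principal_ideal A q%:R x); last first.
  by exists e.+1, x.
have [|e' [y' [le_e' Ay' nqy' norm_y']]] := IHe y Ay; last first.
  by exists e', y'; split=> //; exact: leqW.
apply: (mulfI q0); apply: (mulfI q0).
have -> : q%:R * (q%:R * (y * y^*)) = x * x^*.
  by rewrite -def_x rmorphM rmorph_nat mulrACA mulrA.
by rewrite norm_x mulnS -addnA exprD expr2 -mulrA mulrCA [t%:R * (_ * _)]mulrCA.
Qed.

(** Induction on (s): a prime containing s contains t, so it is some (p), and p divides x or y.
    Cancelling p there and in s enlarges (s), and non-membership survives since w in Q1 would give p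
    w in Q1 (likewise for Q2). When s is a unit, its inverse is absorbed into x. *)
Lemma strip_principal_factors (t : nat) (c : algC) (Q1 Q2 : set algC) :
  (0 < t)%N -> A c -> is_ideal A Q1 -> is_ideal A Q2 ->
  (forall P, is_prime_ideal A P ->
     ideal_divides A P (principal_ideal A t%:R) -> is_principal A P) ->
  forall s x y, A s -> principal_ideal A s t%:R -> A x -> A y -> ~ Q1 x -> ~ Q2 y ->
    x * y = s * c ->
  exists x' y', [/\ A x', A y', ~ Q1 x', ~ Q2 y' & x' * y' = c].
Proof.
move=> t_gt0 Ac idQ1 idQ2 t_principal s x y As st.
have ids := principal_is_ideal As.
(* The ideal (s) becomes a variable, so that the induction runs over ideals containing t while s, x
   and y vary. *)
move: {2}(principal_ideal A s) (erefl (principal_ideal A s)) => I defI.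
have idI : is_ideal A I by rewrite -defI.
have It : I t%:R by rewrite -defI.
move: I idI It s x y As st ids defI.
apply: (@ideal_noeth_ind m z z_prim t) => // I idI It IH.
move=> s x y As st ids defI Ax Ay nQx nQy xy.
have t0 : t%:R != 0 :> algC by rewrite pnatr_eq0 -lt0n.
have s0 : s != 0 by apply: contraNneq t0 => s0; case: st => w _ <-; rewrite s0 mul0r.
have [[s' As' ss']|nunit] := pselect (principal_ideal A s 1).
  exists (s' * x), y; split=> //; first exact: adjM.
    by move=> /(idealMl idQ1 As); rewrite mulrA ss' mul1r.
  by rewrite -mulrA xy mulrA [s' * s]mulrC ss' mul1r.
have [P prP sP] := prime_ideal_exists z_prim t_gt0 ids st nunit.
have [idP _ PM] := prP.
have Pt : P t%:R by exact: sP.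
have [p Ap defP] := t_principal P prP (prime_ideal_divides m_gt1 z_prim t_gt0 prP Pt).
have Ps : P s by apply: sP; exact: principal_self.
have := Ps; rewrite {1}defP => -[s1 As1 def_s].
have p0 : p != 0 by apply: contraNneq s0 => p0; rewrite -def_s p0 mul0r.
have s10 : s1 != 0 by apply: contraNneq s0 => s10; rewrite -def_s s10 mulr0.
have ids1 := principal_is_ideal As1.
have s1s : principal_ideal A s1 s by exists p; rewrite // mulrC.
have s1t : principal_ideal A s1 t%:R by exact: (principal_le ids1 s1s).
have IHs1 := IH (principal_ideal A s1) ids1 _ _ s1 _ _ As1 s1t ids1 erefl.
have sub1 : I `<=` principal_ideal A s1 by rewrite -defI; exact: principal_le.
(* If (s) = (s1) with s = p s1, then p would be a unit, against the properness of P. *)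
have neq1 : I <> principal_ideal A s1.
  move=> eI; have := principal_self z s1; rewrite -eI -defI => -[w Aw].
  rewrite -def_s mulrAC -{2}[s1]mul1r => /(mulIf s10) pw.
  apply: (prime_ideal_proper prP); rewrite defP -pw; exists w => //.
have : P (x * y) by rewrite xy; exact: (idealMr idP).
move=> /(PM _ _ Ax Ay)[]; rewrite {1}defP => -[w Aw def_w].
  apply: (IHs1 sub1 neq1 w y) => //.
    by move=> Qw; apply: nQx; rewrite -def_w; exact: (idealMl idQ1).
  by apply: (mulfI p0); rewrite mulrA def_w xy -def_s mulrA.
apply: (IHs1 sub1 neq1 x w) => //.
  by move=> Qw; apply: nQy; rewrite -def_w; exact: (idealMl idQ2).
by apply: (mulfI p0); rewrite mulrCA def_w xy -def_s mulrA.
Qed.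

(** Put r = 1 - x w, which lies in R and is 1 modulo x. For u in Q^n, split u = u (1 - r^n) + u r^n:
    the first term is a multiple of x, the second lies in Q^n R^n = (q^n) = (x y). *)
Lemma pow_le_principal Q R q n x y w : is_ideal A Q -> is_ideal A R -> A q ->
  ideal_mul Q R = principal_ideal A q -> A x -> A y -> x != 0 -> x * y = q ^+ n ->
  A w -> R (1 - x * w) -> forall u, ideal_pow A Q n u -> A (x^-1 * u).
Proof.
move=> idQ idR Aq QR Ax Ay x0 xy Aw Rw u Qu.
have idx := principal_is_ideal Ax.
have Au := ideal_sub (is_ideal_pow n idQ) Qu.
suff [v Av <-] : principal_ideal A x u by rewrite mulKf.
have xr : principal_ideal A x (1 - (1 - x * w) ^+ n).
  rewrite -[1 in X in X - _](expr1n _ n); apply: (ideal_modX idx); first exact: adj1.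
    by apply: adjB; [exact: adj1|exact: adjM].
  by rewrite subKr; exists w.
rewrite -[u]mulr1 -(subrK ((1 - x * w) ^+ n) 1) mulrDr; apply: (idealD idx).
  exact: (idealMl idx).
have : ideal_mul (ideal_pow A Q n) (ideal_pow A R n) (u * (1 - x * w) ^+ n).
  by apply: ideal_mul_in => //; exact: ideal_powX.
rewrite (ideal_pow_mul _ idQ idR Aq QR) -xy => -[v Av <-].
by exists (y * v); [exact: adjM|rewrite mulrA].
Qed.

End NormEquation.

(** * The two primes above q and the contradiction with the class number *)

Theorem theorem4p2 (m : nat) (z : algC) (t e q : nat)
  (m_gt0 : (0 < m)%N)
  (z_prim : m.-primitive_root z)
  (h_ge2 : (2 <= class_number (rat_adjoin z))%N)
  (t_ge1 : (1 <= t)%N)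
  (q_prime : prime q)
  (q_ndvd_t : ~~ (q %| t)%N)
  (q_coprime_m : coprime q m)
  (q_order : is_mult_order m q (totient m %/ 2)%N)
  (gcd_h : forall k : nat, (k < e)%N ->
     gcdn (2 * e + 1 - 2 * k)%N (class_number (rat_adjoin z)) = 1%N)
  (t_principal : forall P : set algC,
     is_prime_ideal (int_adjoin z) P ->
     ideal_divides (int_adjoin z) P (principal_ideal (int_adjoin z) t%:R) ->
     is_principal (int_adjoin z) P)
  (q_nonprincipal : forall P : set algC,
     is_prime_ideal (int_adjoin z) P ->
     ideal_divides (int_adjoin z) P (principal_ideal (int_adjoin z) q%:R) ->
     ~ is_principal (int_adjoin z) P) :
  ~ (exists2 alpha : algC, int_adjoin z alpha
       & alpha * alpha^* = t%:R * q%:R ^+ (2 * e + 1)).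
Proof.
move=> [alpha Aalpha norm_alpha].
(* For m = 1 and m = 2 the totient is 1, and its half rounds down to 0, which is not an order. *)
have m_gt2 : (2 < m)%N.
  have [f_gt0 _ _] := q_order.
  by case: m m_gt0 f_gt0 {z_prim q_coprime_m q_order} => [|[|[|]]].
have m_gt1 : (1 < m)%N := ltnW m_gt2.
set A := int_adjoin z in Aalpha t_principal q_nonprincipal *.
have q_gt0 := prime_gt0 q_prime.
have q0 : q%:R != 0 :> algC by rewrite pnatr_eq0 -lt0n.
have Aq : A q%:R := adj_nat z q; have idq := principal_is_ideal Aq.
have q_self := principal_self z q%:R.
have nq1 : ~ principal_ideal A q%:R 1.
  move=> /(principal_nat (n := 1) z_prim q_gt0); rewrite dvdn1 => /eqP q1.
  by rewrite q1 in q_prime.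
have [Q prQ sqQ] := prime_ideal_exists z_prim q_gt0 idq q_self nq1.
have [idQ _ QM] := prQ; have Qq : Q q%:R by exact: sqQ.
have [s [val_s gs]] := gal_exists m_gt1 z_prim q_coprime_m.
have [a index2] := mult_order_index2 m_gt1 m_gt2 val_s q_order.
have galX u i x : A x -> Q (gal m_gt1 (s ^+ i * u)%g x) <-> Q (gal m_gt1 u x).
  exact: (gal_frobX z_prim q_prime prQ Qq).
have galX1 i x : A x -> Q (gal m_gt1 (s ^+ i)%g x) <-> Q x.
  by move=> Ax; rewrite -[(s ^+ i)%g]mulg1 galX // (gal1 m_gt1 z_prim).
(* [R] is the conjugate of [Q] for the coset outside the powers of q; at this point it may still
   equal [Q]. *)
pose R := conj_ideal z m_gt1 Q a.
have prR : is_prime_ideal A R := conj_ideal_prime m_gt1 z_prim a prQ.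
have [idR _ RM] := prR.
have Rq : R q%:R by split; rewrite ?rmorph_nat.
have RE x : A x -> R x <-> Q (gal m_gt1 a x) by move=> Ax; split=> [[]|].
(* Membership in [Q] controls the conjugates in the subgroup generated by [s], membership in [R]
   those in the other coset. *)
have QR_q x : Q x -> R x -> principal_ideal A q%:R x.
  move=> Qx [Ax Qax].
  apply: (prime_over_conjugates (m_gt1 := m_gt1) z_prim q_prime q_coprime_m prQ) => // u.
  by have [i [->|->]] := index2 u; [rewrite galX1 | rewrite galX].
have QR : ideal_mul Q R = principal_ideal A q%:R.
  apply/seteqP; split.
    apply: ideal_mul_ind; [exact: (ideal0 idq)|by move=> *; exact: (idealD idq)|].
    move=> x y Qx Ry; apply: QR_q.
      by apply: (idealMr idQ) => //; exact: (ideal_sub idR).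
    by apply: (idealMl idR) => //; exact: (ideal_sub idQ).
  apply: (principal_le (is_ideal_mul idQ idR)).
  (* If [Q] were contained in [R], it would equal their intersection (q) and be principal. *)
  have [x Qx nRx] : exists2 x, Q x & ~ R x.
    apply: contrapT => nex; apply: (q_nonprincipal Q prQ); last first.
      exists q%:R => //; apply/seteqP; split; last exact: sqQ.
      move=> x Qx; apply: QR_q => //; apply: contrapT => nRx.
      by apply: nex; exists x.
    exact: (prime_ideal_divides m_gt1 z_prim q_gt0).
  have Ax := ideal_sub idQ Qx.
  have [w Aw Rw] := prime_over_maximal m_gt1 z_prim q_prime q_coprime_m prR Rq Ax nRx.
  have -> : q%:R = q%:R * (1 - x * w) + (x * w) * q%:R :> algC.
    by rewrite mulrBr mulr1 [x * w * _]mulrC subrK.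
  apply: ideal_mulD; apply: ideal_mul_in => //.
  exact: (idealMr idQ).
have [e' [y [le_e' Ay nqy norm_y]]] :=
  norm_equation_descent m_gt1 z_prim q_prime q_ndvd_t Aalpha norm_alpha.
have Ay' := conj_adj m_gt1 z_prim Ay.
set n := (2 * e' + 1)%N in norm_y.
have Q_norm : Q (y * y^*).
  rewrite norm_y; apply: (idealMl idQ); first exact: adj_nat.
  by apply: (idealX idQ) => //; rewrite /n addn1.
have [c conj_c] := conj_gen m_gt1 z_prim.
(* The two factors are y and its conjugate, ordered so that the first avoids [Q] and the second
   avoids [R]. *)
have [x1 [x2 [Ax1 Ax2 nQx1 nRx2 x12]]] : exists x1 x2,
    [/\ A x1, A x2, ~ Q x1, ~ R x2 & x1 * x2 = t%:R * q%:R ^+ n].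
  (* If conjugation is a power of [s], it preserves [Q] and [R]; both contain the norm, so both
     contain y, which puts y in (q). *)
  have [i [def_c|def_c]] := index2 c.
    case: nqy; have conjQ x : A x -> Q x^* <-> Q x.
      by move=> Ax; rewrite conj_c // def_c galX1.
    have conjR x : A x -> R x^* <-> R x.
      move=> Ax; rewrite !RE //; last exact: conj_adj m_gt1 z_prim _ Ax.
      (* The Galois group is abelian. *)
      have -> : gal m_gt1 a x^* = (gal m_gt1 a x)^*.
        rewrite !conj_c //; last exact: (gal_adj m_gt1 z_prim).
        rewrite !(galM m_gt1 z_prim) //; congr (gal m_gt1 _ x).
        by apply/val_inj; rewrite !FinRing.val_unitM mulrC.
      by rewrite conjQ //; exact: (gal_adj m_gt1 z_prim).
    have R_norm : R (y * y^*).
      rewrite norm_y; apply: (idealMl idR); first exact: adj_nat.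
      by apply: (idealX idR) => //; rewrite /n addn1.
    apply: QR_q.
      by case: (QM _ _ Ay Ay' Q_norm) => // /(conjQ _ Ay).
    by case: (RM _ _ Ay Ay' R_norm) => // /(conjR _ Ay).
  (* In the other coset conjugation exchanges [Q] and [R]. *)
  have conjQ x : A x -> Q x^* <-> R x.
    by move=> Ax; rewrite conj_c // def_c galX // RE.
  (* By [QR_q], y cannot lie in both primes, so y in [Q] avoids [R] and its conjugate avoids [Q]. *)
  have [Qy|nQy] := pselect (Q y).
    exists y^*, y; split=> //; last by rewrite mulrC.
      by move=> /(conjQ _ Ay) Ry; apply: nqy; exact: QR_q.
    by move=> Ry; apply: nqy; exact: QR_q.
  exists y, y^*; split=> // /(conjQ _ Ay').
  by rewrite conjCK.
have Aqn : A (q%:R ^+ n) := adjX n Aq.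
have [x [w [Ax Aw nQx nRw xw]]] := strip_principal_factors m_gt1 z_prim t_ge1 Aqn
  idQ idR t_principal (adj_nat z t) (principal_self z _) Ax1 Ax2 nQx1 nRx2 x12.
have xw0 : x * w != 0 by rewrite xw expf_neq0.
have [x0 w0] : x != 0 /\ w != 0 by move: xw0; rewrite mulf_eq0 negb_or => /andP.
have [u Au Qu] := prime_over_maximal m_gt1 z_prim q_prime q_coprime_m prQ Qq Ax nQx.
have [v Av Rv] := prime_over_maximal m_gt1 z_prim q_prime q_coprime_m prR Rq Aw nRw.
have RQ : ideal_mul R Q = principal_ideal A q%:R by rewrite ideal_mulC.
(* From x w = q^n, with x invertible modulo [Q] and w modulo [R], R^n lies in (x) and Q^n in (w),
   while R^n Q^n = (x w). *)
have Rn : ideal_pow A R n = principal_ideal A x.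
  apply: (@factor_principal _ _ (ideal_pow A Q n) _ w) => //;
    try exact: is_ideal_pow.
  - exact: (pow_le_principal idR idQ Aq RQ Ax Aw x0 xw Au Qu).
  - by apply: (pow_le_principal idQ idR Aq QR Aw Ax w0 _ Av Rv); rewrite mulrC.
  - by rewrite (ideal_pow_mul _ idR idQ Aq RQ) xw.
apply: (q_nonprincipal R prR); first by exists Q.
apply: (principal_of_coprime_power m_gt1 z_prim _ idQ Aq q0 RQ _ Ax x0 Rn).
- by split=> //; exists q%:R.
- by rewrite /n addn1.
- exact: ltnW.
(* For e' > 0 the hypothesis at k = e - e' < e gives the exponent 2 e' + 1 = n. The value e' = 0
   would need k = e, outside its range, but then n = 1. *)
- have [e'0|e'_gt0] := posnP e'; first by rewrite /n e'0 coprime1n.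
  rewrite /coprime -(gcd_h (e - e')%N); last first.
    by rewrite ltn_subrL e'_gt0 (leq_trans e'_gt0).
  by rewrite -/n mulnBr -addnBAC ?leq_subr ?subKn // leq_mul2l le_e' orbT.
Qed.
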